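(* Let $d\in\mathbb{Z}_{\ge 2}$ and suppose that $(\mathbf{R},\le)$ is an ordered field satisfying $[\mathrm{IVT}]_{d^2}$. Let $x_0,x_1,y_0,y_1\in\mathbf{R}$ with $x_0<x_1$, $y_0<y_1$, let $\Gamma:=[x_0,x_1]\times[y_0,y_1]\subset\mathbf{R}^2$, and let $F\in\mathbf{C}[X,Y]$ with $\deg F\le d$ be such that $F$ does not vanish on $\Gamma$. If $F$ is well-controlled, then $w(F\,|\,\partial\Gamma)=0$.
   Context: $(\mathbf{R},\le)$ is an ordered field and $\mathbf{C}=\mathbf{R}[i]$ with $i^2=-1$. For $n\in\mathbb{Z}_{\ge1}$, $[\mathrm{IVT}]_n$ is the property: for every $F\in\mathbf{R}[X]$ with $\deg F\le n$ and every $a<b$ in $\mathbf{R}$ with $F(a)F(b)<0$, there is $c\in\mathbf{R}$ with $a<c<b$ and $F(c)=0$. Real and imaginary parts: for $F\in\mathbf{C}[X,Y]$, $F_{\rm re},F_{\rm im}\in\mathbf{R}[X,Y]$ are the unique polynomials with $F=F_{\rm re}+iF_{\rm im}$. $\deg F$ is the total degree. Well-controlled: $F\in\mathbf{C}[X,Y]$ is well-controlled if (1) $F_{\rm re}\ne0$ and $F_{\rm im}\neq 0$; and (2) $\deg_XF_{\rm im}\ne\deg_XF_{\rm re}$ and $\deg_YF_{\rm im}\ne\deg_YF_{\rm re}$. Cauchy index: for $x\in\mathbf{R}$ and $P,Q\in\mathbf{R}[X]\setminus\{0\}$ write uniquely $P=(X-x)^{\mu(x)}\widetilde P$, $Q=(X-x)^{\nu(x)}\widetilde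 Q$ with $\mu(x),\nu(x)\in\mathbb{Z}_{\ge0}$, $\widetilde P(x)\ne0$, $\widetilde Q(x)\neq0$. Put $\mathrm{Ind}_x^{+}(Q,P)=\frac12\mathrm{sign}(\widetilde Q(x)\widetilde P(x))$ and $\mathrm{Ind}_x^{-}(Q,P)=\frac12(-1)^{\mu(x)-\nu(x)}\mathrm{sign}(\widetilde Q(x)\widetilde P(x))$ if $\mu(x)>\nu(x)$, and both equal to $0$ otherwise; put $\mathrm{Ind}_x(Q,P)=\mathrm{Ind}_x^+(Q,P)-\mathrm{Ind}_x^-(Q,P)$. For $a<b$ and $P,Q\neq0$, $\mathrm{Ind}_a^b(Q,P)=\mathrm{Ind}_a^+(Q,P)+\sum_{x\in(a,b)}\mathrm{Ind}_x(Q,P)-\mathrm{Ind}_b^-(Q,P)$ (only roots of $P$ in $(a,b)$ contribute). For $a>b$ and $P,Q\ne0$, $\mathrm{Ind}_a^b(Q,P)=-\mathrm{Ind}_b^a(Q,P)$. In every other case ($a=b$, or $P=0$, or $Q=0$), $\mathrm{Ind}_a^b(Q,P)=0$. Winding number: for $\Gamma=[x_0,x_1]\times[y_0,y_1]$ and $F\in\mathbf{C}[X,Y]$, $$w(F\,|\,\partial\Gamma)=\tfrac12\Big(\mathrm{Ind}_{x_0}^{x_1}(F_{\rm re}(X,y_0),F_{\rm im}(X,y_0))+\mathrm{Ind}_{y_0}^{y_1}(F_{\rm re}(x_1,Y),F_{\rm im}(x_1,Y))+\mathrm{Ind}_{x_1}^{x_0}(F_{\rm re}(X,y_1),F_{\rm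 im}(X,y_1))+\mathrm{Ind}_{y_1}^{y_0}(F_{\rm re}(x_0,Y),F_{\rm im}(x_0,Y))\Big).$$ *)

(* Defs.v *)
From HB Require Import structures.
From mathcomp Require Import all_boot all_order all_algebra.
From mathcomp Require Import complex.
From mathcomp Require Import boolp classical_sets fsbigop.

Set Implicit Arguments.
Unset Strict Implicit.
Unset Printing Implicit Defensive.
Import Order.TTheory GRing.Theory Num.Theory.
Local Open Scope ring_scope.

Definition IVT (R : realFieldType) (n : nat) : Prop :=
  forall (F : {poly R}) (a b : R), (size F <= n.+1)%N -> a < b ->
    F.[a] * F.[b] < 0 -> exists c : R, a < c < b /\ F.[c] = 0.

(* As in polyXY, an element of A[X, Y] is an F : {poly {poly A}} whose outer
   variable is X and whose coefficients are polynomials in Y: the coefficient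
   of X^i Y^j is F`_i`_j, and F(x, y) is F.[x, y] := F.[x%:P].[y]. Hence
   deg_X F is (size F).-1 and deg_Y F is (sizeY F).-1. *)
Section Bivariate.
Variable A : nzRingType.
Implicit Types F : {poly {poly A}}.

(* The total degree, with the convention that it is 0 for F = 0. *)
Definition total_degree F : nat :=
  \max_(i < size F | F`_i != 0) (i + (size (F`_i)%R).-1)%N.

(* F(X, y) *)
Definition specY F (y : A) : {poly A} := map_poly (horner_eval y) F.

(* F(x, Y) *)
Definition specX F (x : A) : {poly A} := F.[x%:P].

End Bivariate.

Section ReIm.
Variable R : realFieldType.
Implicit Types F : {poly {poly R[i]}}.

Definition re_part F : {poly {poly R}} := map_poly (map_poly (@complex.Re R)) F.
Definition im_part F : {poly {poly R}} := map_poly (map_poly (@complex.Im R)) F.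

Lemma re_im_partP F (G H : {poly {poly R}}) :
  F = map_poly (map_poly (real_complex R)) G
      + (Complex 0 1)%:P%:P * map_poly (map_poly (real_complex R)) H
  <-> G = re_part F /\ H = im_part F.
Proof.
have E x y : x%:C%C + Complex 0 1 * y%:C%C = Complex x y :> R[i].
  rewrite -[LHS]/(Complex (x + (0 * y - 1 * 0)) (0 + (0 * 0 + 1 * y))).
  by rewrite !mul0r !mul1r subr0 add0r addr0 add0r.
have reE i j : (re_part F)`_i`_j = complex.Re F`_i`_j.
  by rewrite /re_part !coef_map_id0 // map_polyE polyseq0 /=; apply/val_inj;
    rewrite /= polyseq0.
have imE i j : (im_part F)`_i`_j = complex.Im F`_i`_j.
  by rewrite /im_part !coef_map_id0 // map_polyE polyseq0 /=; apply/val_inj;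
    rewrite /= polyseq0.
split=> [FE|[-> ->]].
  by split; apply/polyP=> i; apply/polyP=> j; rewrite ?reE ?imE FE coefD
    coefCM !coef_map coefD coefCM !coef_map E.
apply/polyP=> i; apply/polyP=> j.
rewrite coefD coefCM !coef_map coefD coefCM !coef_map reE imE E.
by case: (F`_i`_j).
Qed.

Definition well_controlled F : Prop :=
  [/\ re_part F != 0, im_part F != 0,
      size (im_part F) != size (re_part F)
    & sizeY (im_part F) != sizeY (re_part F)].

End ReIm.

Section CauchyIndex.
Variable R : realFieldType.
Implicit Types (P Q : {poly R}) (a b x : R).

(* The cofactor of the highest power of 'X - x dividing P != 0. *)
Definition cofactor_at x P : {poly R} := P %/ ('X - x%:P) ^+ mup x P.

Lemma cofactor_atP x P : P != 0 ->
  P = ('X - x%:P) ^+ mup x P * cofactor_at x P /\ (cofactor_at x P).[x] != 0.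
Proof.
move=> P0; have dP : ('X - x%:P) ^+ mup x P %| P by rewrite -mup_geq.
have PE : P = ('X - x%:P) ^+ mup x P * cofactor_at x P.
  by rewrite mulrC divpK.
split=> //; apply/negP=> r0.
have /negP[] : ~~ (('X - x%:P) ^+ (mup x P).+1 %| P) by rewrite -mup_leq.
by rewrite {2}PE exprSr dvdp_mul // dvdp_XsubCl.
Qed.

Definition Ind_right x Q P : rat :=
  if (mup x Q < mup x P)%N then
    2^-1 * (sgz ((cofactor_at x Q).[x] * (cofactor_at x P).[x]))%:~R
  else 0.

Definition Ind_left x Q P : rat :=
  if (mup x Q < mup x P)%N then
    2^-1 * (-1) ^+ (mup x P - mup x Q)
      * (sgz ((cofactor_at x Q).[x] * (cofactor_at x P).[x]))%:~R
  else 0.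

Definition Ind_at x Q P : rat := Ind_right x Q P - Ind_left x Q P.

(* The sum is over the support of x |-> Ind_at x Q P in (a, b), which is finite
   because it consists of roots of P (Ind_at_root). *)
Definition Ind_lt a b Q P : rat :=
  Ind_right a Q P
  + \sum_(x \in [set x : R | a < x < b]%classic) Ind_at x Q P
  - Ind_left b Q P.

Definition Ind a b Q P : rat :=
  if (P == 0) || (Q == 0) then 0
  else if a < b then Ind_lt a b Q P
  else if b < a then - Ind_lt b a Q P
  else 0.

Lemma Ind_at_root x Q P : Ind_at x Q P != 0 -> root P x.
Proof.
apply: contraR => /mupNroot rP.
by rewrite /Ind_at /Ind_right /Ind_left rP ltn0 subrr.
Qed.

End CauchyIndex.

(* w(F | bd Gamma) for Gamma = [x0, x1] x [y0, y1]. *)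
Definition winding (R : realFieldType) (F : {poly {poly R[i]}})
    (x0 x1 y0 y1 : R) : rat :=
  let U := re_part F in let V := im_part F in
  2^-1 * (Ind x0 x1 (specY U y0) (specY V y0)
        + Ind y0 y1 (specX U x1) (specX V x1)
        + Ind x1 x0 (specY U y1) (specY V y1)
        + Ind y1 y0 (specX U x0) (specX V x0)).

(* Main.v *)
(* Write U and V for the real and imaginary parts, and let S_0, S_1 be the two of
   them ordered by decreasing X-degree.  Off finitely many heights y the signed
   pseudo-remainder sequence c S_(k-1) = D S_k - S_(k+1), with c an even power of
   the leading coefficient of S_k in R[Y], specializes to a Sturm sequence.  On a
   horizontal strip avoiding these heights, the inversion formula for Cauchy
   indices and this recursion show that the boundary sum of (S_k, S_(k-1)) does
   not depend on k, and at the end of the sequence it vanishes.  The inversion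
   formula needs the intermediate value property for S_k on vertical edges: S_k
   is proportional to a subresultant, of degree at most d^2 by a weight
   count, and the proportionality factors are quotients of products of
   polynomials in Y of degree at most d^2.  Around an exceptional height y, the
   polynomials U(X, y) and V(X, y) have no common zero, so [x0, x1] can be cut
   into intervals on which one of them is bounded away from 0; hence the boundary
   sum of a sufficiently thin strip vanishes as well. *)

Require Import Defs.
From mathcomp Require Import all_boot all_order all_algebra.
From mathcomp Require Import complex.
From mathcomp Require Import perm boolp fsbigop.
From mathcomp Require Import ring lra zify.

Set Implicit Arguments.
Unset Strict Implicit.
Unset Printing Implicit Defensive.
Import Order.TTheory GRing.Theory Num.Theory.
Local Open Scope ring_scope.

(** * Sign changes of polynomials *)

Section PolyAnalysis.
Variable R : realFieldType.
Implicit Types (P Q f : {poly R}) (a b c x y : R).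

Lemma poly_roots P : P != 0 ->
  exists2 s : seq R, uniq s & forall x, (x \in s) = root P x.
Proof.
move: {2}(size P) (erefl (size P)) => n; elim/ltn_ind: n P => n IH P Pn P0.
have [[c rc]|nr] := pselect (exists c, root P c); last first.
  exists [::] => // x; rewrite in_nil; apply/esym/negP => rx.
  by apply: nr; exists x.
have /factor_theorem[G PE] := rc.
have G0 : G != 0 by apply: contraNneq P0 => G0; rewrite PE G0 mul0r.
have [|s us sE] := IH (size G) _ G erefl G0.
  by rewrite -Pn PE size_Mmonic ?monicXsubC // size_XsubC addn2.
exists (undup (c :: s)) => [|x]; first exact: undup_uniq.
by rewrite mem_undup inE sE PE rootM root_XsubC orbC.
Qed.

(** Induction on [s]: an interval free of the remaining points is cut at [c] when [c] lies inside
    it. With [s] the roots of a polynomial, only intervals without interior roots remain. *)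
Lemma interval_split_ind (s : seq R) (A B : R) (Phi : R -> R -> Prop) :
  (forall a b c, b \in s -> A <= a -> a < b -> b < c -> c <= B ->
     Phi a b -> Phi b c -> Phi a c) ->
  (forall a b, A <= a -> a < b -> b <= B ->
     (forall x, x \in s -> a < x -> x < b -> False) -> Phi a b) ->
  forall a b, A <= a -> a < b -> b <= B -> Phi a b.
Proof.
elim: s => [|c s IH] add base; first by move=> a b *; apply: base.
apply: IH => [a b e bs|a b Aa ab bB free].
  by apply: add; rewrite inE bs orbT.
case: (ltP a c) => [ac|ca]; last first.
  apply: base => // x; rewrite inE => /orP[/eqP->|/free//].
  by rewrite ltNge ca.
case: (ltP c b) => [cb|bc]; last first.
  apply: base => // x; rewrite inE => /orP[/eqP-> _|/free//].
  by rewrite ltNge bc.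
apply: (add _ c); rewrite ?mem_head //; apply: base => //; try lra.
  move=> x; rewrite inE => /orP[/eqP-> _|xs ax xc]; first by rewrite ltxx.
  by apply: (free x) => //; lra.
move=> x; rewrite inE => /orP[/eqP->|xs ax xc]; first by rewrite ltxx.
by apply: (free x) => //; lra.
Qed.

Lemma poly_bounded f (M : R) :
  exists2 C : R, 0 <= C & forall x, `|x| <= M -> `|f.[x]| <= C.
Proof.
elim/poly_ind: f => [|f c [C C0 IH]].
  by exists 0 => // x _; rewrite horner0 normr0.
exists (C * `|M| + `|c|) => [|x xM]; first by rewrite addr_ge0 ?mulr_ge0.
rewrite hornerMXaddC (le_trans (ler_normD _ _)) // lerD2r normrM.
by rewrite ler_pM ?IH // (le_trans xM) ?ler_norm.
Qed.

(** Explicit bounds, built along the Horner scheme, stand in for compactness, which fails over a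
    general ordered field. *)
Lemma poly_lipschitz f (M : R) : exists2 C : R, 0 <= C &
  forall x y, `|x| <= M -> `|y| <= M -> `|f.[x] - f.[y]| <= C * `|x - y|.
Proof.
elim/poly_ind: f => [|f c [C C0 IH]].
  by exists 0 => // x y _ _; rewrite !horner0 subr0 normr0 mul0r.
have [K K0 fK] := poly_bounded f M.
exists (C * `|M| + K) => [|x y xM yM]; first by rewrite addr_ge0 ?mulr_ge0.
rewrite !hornerMXaddC.
have -> : f.[x] * x + c - (f.[y] * y + c) =
  (f.[x] - f.[y]) * x + f.[y] * (x - y) by ring.
rewrite (le_trans (ler_normD _ _)) // !normrM mulrDl lerD //.
  rewrite mulrAC ler_pM ?IH //.
  by rewrite (le_trans xM) ?ler_norm.
by rewrite ler_wpM2r ?fK.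
Qed.

Lemma sgz_near f a : f.[a] != 0 -> exists2 e : R, 0 < e &
  forall y, `|y - a| < e -> sgz f.[y] = sgz f.[a].
Proof.
move=> fa0; have [C C0 lip] := poly_lipschitz f (`|a| + 1).
have fa : 0 < `|f.[a]| by rewrite normr_gt0.
have C1 : 0 < C + 1 by lra.
(* Within this radius the Lipschitz bound stays below [|f.[a]|]; the cap 1 keeps [y] where [C] is
   valid, and [C + 1] is a positive denominator. *)
exists (Num.min 1 (`|f.[a]| / (C + 1))) => [|y].
  by rewrite lt_min ltr01 divr_gt0.
rewrite lt_min => /andP[y1]; rewrite ltr_pdivlMr // => ya.
have yM : `|y| <= `|a| + 1.
  by have := ler_normD (y - a) a; rewrite subrK; lra.
have L : `|f.[y] - f.[a]| <= C * `|y - a| by apply: lip => //; lra.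
have {}L : `|f.[y] - f.[a]| < `|f.[a]|.
  apply: le_lt_trans L _; apply: le_lt_trans ya.
  by rewrite mulrC ler_wpM2l //; lra.
have [p|n|z] := ltrgt0P f.[a]; last by rewrite z eqxx in fa0.
  by rewrite !gtr0_sgz //; move: L; rewrite (gtr0_norm p) ltr_distl; lra.
by rewrite !ltr0_sgz //; move: L; rewrite (ltr0_norm n) ltr_distl; lra.
Qed.

Lemma cofactor_uniq x P (G : {poly R}) m :
  P = ('X - x%:P) ^+ m * G -> G.[x] != 0 ->
  mup x P = m /\ cofactor_at x P = G.
Proof.
move=> PE Gx; have mP : mup x P = m.
  rewrite PE mupMl; last by rewrite /root.
  by rewrite mup_XsubCX eqxx.
split=> //; rewrite /cofactor_at mP PE mulKp //.
by rewrite expf_neq0 // polyXsubC_eq0.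
Qed.

Lemma sgz_near_right P a : P != 0 -> exists2 e : R, 0 < e &
  forall y, a < y -> y < a + e -> sgz P.[y] = sgz (cofactor_at a P).[a].
Proof.
move=> P0; have [PE Ga] := cofactor_atP a P0.
have [e e0 near] := sgz_near Ga; exists e => // y ay ye.
rewrite {1}PE hornerM horner_exp !hornerE sgzM near; last first.
  by rewrite ltr_norml; lra.
by rewrite sgzX gtr0_sgz ?expr1n ?mul1r // subr_gt0.
Qed.

Lemma sgz_near_left P a : P != 0 -> exists2 e : R, 0 < e &
  forall y, y < a -> a - e < y ->
    sgz P.[y] = (-1) ^+ mup a P * sgz (cofactor_at a P).[a].
Proof.
move=> P0; have [PE Ga] := cofactor_atP a P0.
have [e e0 near] := sgz_near Ga; exists e => // y ay ye.
rewrite {1}PE hornerM horner_exp !hornerE sgzM near; last first.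
  by rewrite ltr_norml; lra.
by rewrite sgzX ltr0_sgz // subr_lt0.
Qed.

(** A property of one polynomial on one interval: terms of the remainder sequence may exceed the
    degree bound of [IVT] and satisfy it only on suitable intervals. *)
Definition ivt_on a b f := forall u v, a <= u -> u < v -> v <= b ->
  f.[u] * f.[v] < 0 -> exists2 c, u < c < v & f.[c] = 0.

Lemma ivt_onS a b a' b' f : a <= a' -> b' <= b -> ivt_on a b f ->
  ivt_on a' b' f.
Proof. by move=> aa bb H u v au uv vb; apply: H => //; lra. Qed.

(** If a product changes sign then one of its factors does, whatever the degrees. *)
Lemma ivt_onM a b P Q : ivt_on a b P -> ivt_on a b Q -> ivt_on a b (P * Q).
Proof.
move=> HP HQ u v au uv vb; rewrite !hornerM.
rewrite [X in X < 0](_ : _ = (P.[u] * P.[v]) * (Q.[u] * Q.[v])); last by ring.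
move=> H.
have [/(HP _ _ au uv vb)[c cuv Pc]|p] := ltP (P.[u] * P.[v]) 0.
  by exists c; rewrite // hornerM Pc mul0r.
have [/(HQ _ _ au uv vb)[c cuv Qc]|q] := ltP (Q.[u] * Q.[v]) 0.
  by exists c; rewrite // hornerM Qc mulr0.
by have := mulr_ge0 p q; rewrite leNgt H.
Qed.

Lemma sgz_ivt a b f : ivt_on a b f -> forall u v, a <= u -> u < v -> v <= b ->
  (forall x, u <= x -> x <= v -> f.[x] != 0) -> sgz f.[u] = sgz f.[v].
Proof.
move=> H u v au uv vb nz.
have fu := nz u (lexx _) (ltW uv); have fv := nz v (ltW uv) (lexx _).
have [/(H _ _ au uv vb)[c /andP[uc cv] fc]|] := ltP (f.[u] * f.[v]) 0.
  by have := nz c (ltW uc) (ltW cv); rewrite fc eqxx.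
rewrite le0r mulf_eq0 (negPf fu) (negPf fv) /=.
have [p|n|z] := ltrgt0P f.[u]; last by rewrite z eqxx in fu.
  by rewrite pmulr_rgt0 // => q; rewrite !gtr0_sgz.
by rewrite nmulr_rgt0 // => q; rewrite !ltr0_sgz.
Qed.

(** The ends may be roots. Just inside them the sign of [f] is that of its cofactors, up to the sign
    of a power of [X - b] to the left of [b]. *)
Lemma sgz_ivt_ends a b f : f != 0 -> a < b -> ivt_on a b f ->
  (forall x, a < x -> x < b -> f.[x] != 0) ->
  sgz (cofactor_at a f).[a] = (-1) ^+ mup b f * sgz (cofactor_at b f).[b].
Proof.
move=> f0 ab H nz.
have [e e0 near] := sgz_near_right a f0.
have [e' e'0 near'] := sgz_near_left b f0.
(* [u] and [v] lie in the two one-sided neighbourhoods, and the midpoint keeps [u <= v]. *)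
pose m := (a + b) / 2.
have am : a < m by rewrite /m; lra.
have mb : m < b by rewrite /m; lra.
pose u := Num.min m (a + e / 2); pose v := Num.max m (b - e' / 2).
have ua : a < u by rewrite lt_min am; lra.
have um : u <= m by rewrite ge_min lexx.
have ue : u < a + e by rewrite gt_min; apply/orP; right; lra.
have vb : v < b by rewrite gt_max mb; lra.
have mv : m <= v by rewrite le_max lexx.
have ve : b - e' < v by rewrite lt_max; apply/orP; right; lra.
rewrite -(near u) // -(near' v) //.
have [uv|vu] := ltP u v.
  by apply: (sgz_ivt H) => //; try lra; move=> x ux xv; apply: nz; lra.
by congr (sgz f.[_]); lra.
Qed.

End PolyAnalysis.

(** * Cauchy indices *)

Section CauchyIndexTheory.
Variable R : realFieldType.
Implicit Types (P Q D c : {poly R}) (a b x y : R).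

Lemma Ind_lt_seq (s : seq R) a b Q P : uniq s ->
  (forall x, Ind_at x Q P != 0 -> x \in s) ->
  Ind_lt a b Q P =
  Ind_right a Q P + \sum_(x <- s | a < x < b) Ind_at x Q P - Ind_left b Q P.
Proof.
move=> us H; rewrite /Ind_lt; congr (_ + _ - _).
rewrite (@bigfs _ _ _ _ s (fun x => a < x < b)) // => x _ xs.
by apply/eqP; apply: contraNT xs => /H.
Qed.

(** At [b] the two short intervals contribute [Ind_right - Ind_left], which is the interior term
    [Ind_at] of the long one. *)
Lemma Ind_lt_split a b d Q P : P != 0 -> a < b -> b < d ->
  Ind_lt a d Q P = Ind_lt a b Q P + Ind_lt b d Q P.
Proof.
move=> P0 ab bd; have [s us sE] := poly_roots P0.
pose t := undup (b :: s).
have ut : uniq t by rewrite undup_uniq.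
have bt : b \in t by rewrite mem_undup mem_head.
have tE x : Ind_at x Q P != 0 -> x \in t.
  by move=> /Ind_at_root rx; rewrite mem_undup inE sE rx orbT.
rewrite !(Ind_lt_seq _ _ ut tE).
have -> : \sum_(x <- t | a < x < d) Ind_at x Q P =
  Ind_at b Q P + \sum_(x <- t | a < x < b) Ind_at x Q P
  + \sum_(x <- t | b < x < d) Ind_at x Q P.
  rewrite (bigID (pred1 b)) [X in _ + X = _](bigID (fun x => x < b)) /= addrA.
  congr (_ + _ + _).
  - rewrite (eq_bigl (pred1 b)); last first.
      by move=> x /=; case: eqP => [->|]; rewrite ?ab ?bd ?andbF.
    by rewrite -big_filter filter_pred1_uniq // big_seq1.
  - apply: eq_bigl => x; case: (ltgtP x b) => [xb|bx|xb]; rewrite ?andbF ?andbT //.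
    by rewrite (lt_trans xb bd) ?andbT.
  - apply: eq_bigl => x; case: (ltgtP x b) => [xb|bx|xb]; rewrite ?andbF ?andbT //.
    by rewrite (lt_trans ab bx).
by rewrite {1}/Ind_at; ring.
Qed.

Lemma Ind_split a b d Q P : a < b -> b < d ->
  Ind a d Q P = Ind a b Q P + Ind b d Q P.
Proof.
move=> ab bd; rewrite /Ind; case: eqP => [//|/eqP P0] /=; case: eqP => // _.
by rewrite (lt_trans ab bd) ab bd (Ind_lt_split _ P0 ab bd).
Qed.

Lemma Ind_rev a b Q P : Ind b a Q P = - Ind a b Q P.
Proof.
rewrite /Ind; case: ifP => _; first by rewrite oppr0.
by case: ltgtP; rewrite ?opprK ?oppr0.
Qed.

Lemma Ind_0l a b P : Ind a b 0 P = 0. Proof. by rewrite /Ind eqxx orbT. Qed.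
Lemma Ind_0r a b Q : Ind a b Q 0 = 0. Proof. by rewrite /Ind eqxx. Qed.

(** A local comparison, applied with [k = 0] to show vanishing and with [k = -1] to reverse
    signs. *)
Lemma Ind_scale (k : rat) a b Q Q' P : a < b -> P != 0 -> Q != 0 -> Q' != 0 ->
  (forall x, a <= x <= b -> Ind_right x Q' P = k * Ind_right x Q P /\
     Ind_left x Q' P = k * Ind_left x Q P) ->
  Ind a b Q' P = k * Ind a b Q P.
Proof.
move=> ab P0 Q0 Q0' H; rewrite /Ind (negPf P0) (negPf Q0) (negPf Q0') ab /=.
have [s us sE] := poly_roots P0.
have tE T x : Ind_at x T P != 0 -> x \in s by move=> /Ind_at_root; rewrite sE.
rewrite (Ind_lt_seq _ _ us (tE Q)) (Ind_lt_seq _ _ us (tE Q')).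
rewrite (H a _).1 ?(H b _).2 ?lexx ?ltW //.
rewrite !mulrDr mulrN mulr_sumr; congr (_ + _ - _); apply: eq_bigr => x.
case/andP=> ax xb; rewrite /Ind_at (H x _).1 ?(H x _).2 ?mulrBr //.
  by rewrite !ltW.
by rewrite !ltW.
Qed.

Lemma Ind_nopole a b Q P : a < b ->
  (P != 0 -> Q != 0 -> forall x, a <= x <= b -> (mup x P <= mup x Q)%N) ->
  Ind a b Q P = 0.
Proof.
move=> ab H; have [->|P0] := eqVneq P 0; first exact: Ind_0r.
have [->|Q0] := eqVneq Q 0; first exact: Ind_0l.
rewrite (@Ind_scale 0 _ _ Q) ?mul0r // => x xab.
by rewrite /Ind_right /Ind_left ltnNge H //= mulr0.
Qed.

Lemma Ind_noroot a b Q P : a < b -> (forall x, a <= x <= b -> P.[x] != 0) ->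
  Ind a b Q P = 0.
Proof.
by move=> ab H; apply: Ind_nopole => // _ _ x /H Px; rewrite mupNroot.
Qed.

(** Where [c] has no zero, [Q / P = D / c] has no pole. *)
Lemma Ind_dvd a b c D Q P : a < b -> (forall x, a <= x <= b -> c.[x] != 0) ->
  c * Q = D * P -> Ind a b Q P = 0.
Proof.
move=> ab cpos E; apply: Ind_nopole => // P0 Q0 x /cpos cx.
rewrite -(@mupMr _ x c Q); last exact: cx.
rewrite mup_geq; last first.
  by rewrite mulf_neq0 //; apply: contraNneq cx => ->; rewrite horner0.
by rewrite E dvdp_mull // -mup_geq.
Qed.

(** At a pole of [Q / P] the term [D * P] vanishes to higher order than [c * Q], so [Q'] has the
    leading term of [- c * Q]. *)
Lemma cofactor_rem x c D P Q Q' : P != 0 -> Q != 0 -> c.[x] != 0 ->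
  c * Q = D * P - Q' -> (mup x Q < mup x P)%N ->
  mup x Q' = mup x Q /\
  (cofactor_at x Q').[x] = - (c.[x] * (cofactor_at x Q).[x]).
Proof.
move=> P0 Q0 cx E lt.
have [PE Px] := cofactor_atP x P0; have [QE Qx] := cofactor_atP x Q0.
set G := D * (('X - x%:P) ^+ (mup x P - mup x Q) * cofactor_at x P)
         - c * cofactor_at x Q.
have Q'E : Q' = ('X - x%:P) ^+ mup x Q * G.
  have -> : Q' = D * P - c * Q by rewrite E; ring.
  rewrite [in D * P]PE [in c * Q]QE -[in LHS](subnK (ltnW lt)) exprD /G.
  move: (('X - x%:P) ^+ (mup x P - mup x Q)) (('X - x%:P) ^+ mup x Q) => U V.
  move: (cofactor_at x P) (cofactor_at x Q) => p q; ring.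
have Gx : G.[x] = - (c.[x] * (cofactor_at x Q).[x]).
  rewrite /G !(hornerE, horner_exp) subrr expr0n subn_eq0 leqNgt lt /=.
  by rewrite !(mul0r, mulr0) sub0r.
have [|-> ->] := cofactor_uniq Q'E; last by [].
by rewrite Gx oppr_eq0 mulf_neq0.
Qed.

(** Since [Q' / P = D - c * Q / P] with [D] polynomial and [c] positive, the poles are those of
    [Q / P] with opposite signs. *)
Lemma Ind_rem a b c D Q Q' P : a < b -> (forall x, a <= x <= b -> 0 < c.[x]) ->
  c * Q = D * P - Q' -> Ind a b Q' P = - Ind a b Q P.
Proof.
move=> ab cpos E.
have [->|P0] := eqVneq P 0; first by rewrite !Ind_0r oppr0.
have [Q0|Q0] := eqVneq Q 0.
  rewrite Q0 Ind_0l oppr0; apply: (@Ind_dvd _ _ 1 D) => // [x _|].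
    by rewrite hornerE oner_eq0.
  by apply/eqP; rewrite mul1r eq_sym -subr_eq0 -E Q0 mulr0.
have [Q0'|Q0'] := eqVneq Q' 0.
  rewrite Q0' Ind_0l; apply/eqP; rewrite eq_sym oppr_eq0; apply/eqP.
  apply: (@Ind_dvd _ _ c D) => // [x /cpos/gt_eqF-> //|].
  by rewrite E Q0' subr0.
rewrite -mulN1r; apply: Ind_scale => // x /cpos cx.
rewrite /Ind_right /Ind_left.
have [lt|ge] := ltnP (mup x Q) (mup x P).
  have [|-> ->] := cofactor_rem P0 Q0 _ E lt; first by rewrite gt_eqF.
  have -> : - (c.[x] * (cofactor_at x Q).[x]) * (cofactor_at x P).[x] =
    - (c.[x] * ((cofactor_at x Q).[x] * (cofactor_at x P).[x])) by ring.
  rewrite lt sgzN [sgz (c.[x] * _)]sgzM (gtr0_sgz cx) mul1r rmorphN /=.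
  by rewrite !mulN1r !mulrN.
case: ltnP => lt; last by rewrite !mulr0.
have c0 : c != 0 by apply: contraTneq cx => ->; rewrite horner0 ltxx.
(* A pole of [Q' / P] alone is excluded by the same relation with [Q'] and [c * Q] exchanged. *)
have E' : 1 * Q' = D * P - c * Q by rewrite E; ring.
have [|muQ _] := cofactor_rem P0 Q0' _ E' lt; first by rewrite hornerE oner_eq0.
have rc : ~~ root c x by rewrite /root gt_eqF.
by move: ge; rewrite -(mupMr Q rc) muQ leqNgt lt.
Qed.

Lemma cofactor_mul x P Q : P != 0 -> Q != 0 ->
  mup x (P * Q) = (mup x P + mup x Q)%N /\
  cofactor_at x (P * Q) = cofactor_at x P * cofactor_at x Q.
Proof.
move=> P0 Q0.
have [PE Px] := cofactor_atP x P0; have [QE Qx] := cofactor_atP x Q0.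
apply: cofactor_uniq; last by rewrite hornerM mulf_neq0.
by rewrite {1}PE {1}QE exprD mulrACA.
Qed.

(** At most one factor vanishes at [x]. If none does, the two half signs agree and no index
    contributes; if one does, [sgz f.[x]] is 0 and the index with that factor as denominator is the
    remaining half sign. *)
Lemma Ind_side_add x P Q : P != 0 -> Q != 0 ->
  ~ (P.[x] = 0 /\ Q.[x] = 0) ->
  let f := P * Q in
  Ind_right x Q P + Ind_right x P Q =
    2^-1 * (sgz (cofactor_at x f).[x])%:~R - 2^-1 * (sgz f.[x])%:~R /\
  Ind_left x Q P + Ind_left x P Q =
    2^-1 * ((-1) ^+ mup x f * sgz (cofactor_at x f).[x])%:~R
    - 2^-1 * (sgz f.[x])%:~R.
Proof.
move=> P0 Q0 nz /=; have [-> ->] := cofactor_mul x P0 Q0.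
have [PE Px] := cofactor_atP x P0; have [QE Qx] := cofactor_atP x Q0.
have co1 T : mup x T = 0%N -> cofactor_at x T = T.
  by move=> T0; rewrite /cofactor_at T0 expr0 divp1.
have z T : T != 0 -> (0 < mup x T)%N -> T.[x] = 0.
  move=> T0 m; apply/eqP; rewrite -[_ == _]/(root T x) -dvdp_XsubCl.
  by rewrite XsubC_dvd.
rewrite /Ind_right /Ind_left !hornerM !intrM !rmorphXn /= !rmorphN1.
have [Pm|Pm] := posnP (mup x P).
  rewrite Pm (co1 _ Pm) ltn0 add0n !add0r.
  have [Qm|Qm] := posnP (mup x Q).
    by rewrite Qm (co1 _ Qm) expr0 mul1r subrr.
  by rewrite (z Q) // mulr0 sgz0 !mulr0 !subr0 subn0 ?mulrA.
have Pz := z P P0 Pm.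
have [Qm|Qm] := posnP (mup x Q); last by case: nz; rewrite Pz (z Q).
rewrite Qm (co1 _ Qm) Pm ltn0 addn0 subn0 !addr0 Pz mul0r sgz0 !mulr0 !subr0.
by rewrite [Q.[x] * _]mulrC ?mulrA.
Qed.

Definition half_sgn P Q x : rat := 2^-1 * (sgz (P.[x] * Q.[x]))%:~R.

(* [P * Q] changes sign exactly at the poles of [Q / P] and [P / Q], so the sum
   of the two indices telescopes to the variation of the sign of [P * Q]. *)
Lemma Ind_inversion a b P Q : a < b -> ivt_on a b P -> ivt_on a b Q ->
  (forall x, a <= x <= b -> ~ (P.[x] = 0 /\ Q.[x] = 0)) ->
  Ind a b Q P + Ind a b P Q = half_sgn P Q b - half_sgn P Q a.
Proof.
move=> ab HP HQ nz; have [P0|P0] := eqVneq P 0.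
  by rewrite /half_sgn P0 Ind_0r Ind_0l !horner0 !mul0r sgz0 mulr0 subr0.
have [Q0|Q0] := eqVneq Q 0.
  by rewrite /half_sgn Q0 Ind_0r Ind_0l !horner0 !mulr0 sgz0 mulr0 subr0.
have f0 : P * Q != 0 by rewrite mulf_neq0.
have [s us sE] := poly_roots f0.
apply: (@interval_split_ind _ s a b (fun a b =>
  Ind a b Q P + Ind a b P Q = half_sgn P Q b - half_sgn P Q a)) => //.
  move=> u v w _ au uv vw wb E1 E2; rewrite !(@Ind_split u v w) //.
  by rewrite addrACA E1 E2; ring.
move=> u v au uv vb free.
have nzf x : u < x -> x < v -> (P * Q).[x] != 0.
  by move=> ux xv; apply/negP => /=; rewrite -[_ == _]/(root _ x) -sE => /free; exact.
have HF : ivt_on u v (P * Q) by apply: ivt_onS (ivt_onM HP HQ).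
have := sgz_ivt_ends f0 uv HF nzf.
have [|R1 _] := Ind_side_add P0 Q0 (x := u); first by apply: nz; lra.
have [|_ L1] := Ind_side_add P0 Q0 (x := v); first by apply: nz; lra.
move=> ends.
have noat T S x : T != 0 -> (T %| P * Q) -> u < x < v -> Ind_at x S T = 0.
  move=> T0 Td /andP[ux xv]; apply/eqP; apply: contraNT (nzf x ux xv) => /Ind_at_root rT.
  by move: rT; rewrite -[(P * Q).[x] == _]/(root _ x) -!dvdp_XsubCl => /dvdp_trans; apply.
rewrite /Ind (negPf P0) (negPf Q0) uv /= /Ind_lt.
rewrite !fsbig1; last first.
- by move=> x xuv; apply: noat xuv => //; rewrite dvdp_mulr.
- by move=> x xuv; apply: noat xuv => //; rewrite dvdp_mull.
rewrite !addr0 addrACA R1 -opprD L1 /half_sgn -!hornerM ends.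
by rewrite opprB addrC subrKA.
Qed.

End CauchyIndexTheory.

(** * Polynomials of degree bounded by the intermediate value property *)

Section LowDegree.
Variables (R : realFieldType) (n : nat) (ivt : IVT R n).
Implicit Types (f : {poly R}) (a b x y u v : R).

Lemma IVT_ivt_on f a b : (size f <= n.+1)%N -> ivt_on a b f.
Proof.
move=> sf u v _ uv _ neg; have [c [cuv fc]] := ivt sf uv neg.
by exists c.
Qed.

(** For [f = (X - x)^(m+1) G] the derivative is [(X - x)^m H] with [H(x) = (m + 1) G(x)], of the
    same sign as [G(x)]. *)
Lemma cofactor_deriv f x : f != 0 -> root f x ->
  [/\ f^`() != 0, mup x f = (mup x f^`()).+1
    & sgz (cofactor_at x f^`()).[x] = sgz (cofactor_at x f).[x]].
Proof.
move=> f0 rx; have [fE Gx] := cofactor_atP x f0.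
move: rx; rewrite -dvdp_XsubCl XsubC_dvd //; move: fE.
set m := mup x f; set G := cofactor_at x f in Gx *.
case: m => // m fE _.
set H := G *+ m.+1 + ('X - x%:P) * G^`().
have dE : f^`() = ('X - x%:P) ^+ m * H.
  rewrite fE derivM deriv_exp derivXsubC /H /= mul1r mulrDr mulrA -exprSr.
  by rewrite mulrnAl mulrnAr.
have Hx : H.[x] = G.[x] *+ m.+1 by rewrite /H !hornerE subrr mul0r addr0 hornerMn.
have Hx0 : H.[x] != 0 by rewrite Hx mulrn_eq0.
have [-> ->] := cofactor_uniq dE Hx0; split=> //.
  by rewrite dE mulf_neq0 ?expf_neq0 ?polyXsubC_eq0 //;
    apply: contraNneq Hx0 => ->; rewrite horner0.
by rewrite Hx -mulr_natr sgzM [sgz _%:R]gtr0_sgz ?mulr1 ?ltr0n.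
Qed.

(** Between consecutive roots of [g = f - f(a)], both [g] and a rootless derivative would satisfy
    [sgz_ivt_ends]. At the ends their cofactors have equal signs while the multiplicities differ by
    one, so the two sign relations contradict each other. *)
Lemma rolle_ivt f a b : (size f <= n.+1)%N -> a < b -> f.[a] = f.[b] ->
  exists2 c, a < c < b & f^`().[c] = 0.
Proof.
move=> sf ab fab; pose g := f - (f.[a])%:P.
have dg : g^`() = f^`() by rewrite /g derivB derivC subr0.
have [g0|g0] := eqVneq g 0.
  exists ((a + b) / 2); first by lra.
  by rewrite -dg g0 deriv0 horner0.
have sg : (size g <= n.+1)%N.
  by rewrite (leq_trans (size_polyD _ _)) // geq_max sf size_polyN
      (leq_trans (size_polyC_leq1 _)).
have [s us sE] := poly_roots g0; rewrite -dg.
have ga : g.[a] = 0 by rewrite /g !hornerE subrr.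
have gb : g.[b] = 0 by rewrite /g !hornerE -fab subrr.
move: ga gb; apply: (@interval_split_ind _ s a b (fun a b =>
  g.[a] = 0 -> g.[b] = 0 -> exists2 c, a < c < b & g^`().[c] = 0)) => //.
  move=> u v w; rewrite sE => /rootP gv _ _ vw _ H _ gu _.
  have [c /andP[uc cv] gc] := H gu gv.
  by exists c => //; rewrite uc (lt_trans cv).
move=> u v au uv vb free gu gv.
have nzg x : u < x -> x < v -> g.[x] != 0.
  by move=> ux xv; apply/negP; rewrite -[_ == _]/(root _ x) -sE => /free; exact.
have [d0 mu su] := cofactor_deriv g0 (introT rootP gu).
have [_ mv sv] := cofactor_deriv g0 (introT rootP gv).
apply: contrapT => H.
have nzd x : u < x -> x < v -> g^`().[x] != 0.
  by move=> ux xv; apply/eqP => dx; apply: H; exists x => //; rewrite ux xv.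
have := sgz_ivt_ends g0 uv (@IVT_ivt_on _ _ _ sg) nzg.
have sdg : (size g^`() <= n.+1)%N by apply: leq_trans sg; rewrite ltnW ?lt_size_deriv.
have := sgz_ivt_ends d0 uv (@IVT_ivt_on _ _ _ sdg) nzd.
rewrite su sv mv exprS => -> /eqP.
have [_ Gv] := cofactor_atP v g0.
rewrite -mulrA mulN1r -addr_eq0 -mulr2n mulrn_eq0 /= mulf_eq0 signr_eq0 /=.
by rewrite sgz_eq0 (negPf Gv).
Qed.

(** By [rolle_ivt] the function is injective; if [f.[x]] were below both end values, the smaller one
    would be taken again between [x] and the other end. *)
Lemma between_ends_low f u v x : (size f <= n.+1)%N ->
  (forall t, u < t -> t < v -> f^`().[t] != 0) ->
  u <= x -> x <= v -> u < v -> Num.min f.[u] f.[v] <= f.[x].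
Proof.
move=> sf nzd ux xv uv; rewrite leNgt lt_min; apply/negP => /andP[xu' xv'].
have inj s t : u <= s -> s < t -> t <= v -> f.[s] != f.[t].
  move=> us st tv; apply/eqP => /(rolle_ivt sf st)[c /andP[sc ct] /eqP].
  by apply/negP/nzd; lra.
have lt1 : u < x by rewrite lt_neqAle ux andbT; apply: contraTneq xu' => ->; rewrite ltxx.
have lt2 : x < v by rewrite lt_neqAle xv andbT; apply: contraTneq xv' => ->; rewrite ltxx.
have ivtC k s t : s < t -> (f.[s] - k) * (f.[t] - k) < 0 ->
    exists2 c, s < c < t & f.[c] = k.
  move=> st neg; have sg : (size (f - k%:P)%R <= n.+1)%N.
    by rewrite (leq_trans (size_polyD _ _)) // geq_max sf size_polyN
      (leq_trans (size_polyC_leq1 _)).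
  have [|c cst /eqP] := IVT_ivt_on sg (lexx s) st (lexx t).
    by rewrite !hornerE.
  by rewrite !hornerE subr_eq0 => /eqP; exists c.
have [fuv|fvu|e] := ltgtP f.[u] f.[v]; last first.
- by have := inj u v (lexx _) uv (lexx _); rewrite e eqxx.
- have [|c /andP[uc cx] fc] := @ivtC f.[v] u x lt1.
    by rewrite pmulr_rlt0 ?subr_gt0 // subr_lt0.
  by have := inj c v; rewrite fc eqxx => /(_ (ltW uc) (lt_trans cx lt2) (lexx _)).
- have [|c /andP[xc cv] fc] := @ivtC f.[u] x v lt2.
    by rewrite nmulr_rlt0 ?subr_gt0 // subr_lt0.
  by have := inj u c; rewrite fc eqxx => /(_ (lexx _) (lt_trans lt1 xc) (ltW cv)).
Qed.

(** Substitute for the extreme value theorem: between consecutive critical points [|f|] is at least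
    the smaller of its end values. *)
Lemma nonvanishing_bounded_below f a b : (size f <= n.+1)%N -> a < b ->
  (forall x, a <= x <= b -> f.[x] != 0) ->
  exists2 m : R, 0 < m & forall x, a <= x <= b -> m <= `|f.[x]|.
Proof.
move=> sf ab nz.
have [d0|d0] := eqVneq f^`() 0.
  have fE x : a <= x <= b -> f.[x] = f.[a].
    case/andP; rewrite le_eqVlt => /predU1P[-> //|ax xb].
    have sg : f = (f`_0)%:P; last by rewrite sg !hornerC.
    apply: size1_polyC; rewrite leqNgt; apply/negP => s1.
    (* This coefficient of the derivative is [lead_coef f] times the degree of [f], nonzero in
       characteristic 0 for nonconstant [f]. *)
    have := congr1 (coefp (size f).-2) d0; rewrite /= coef0 coef_deriv.
    have -> : (size f).-2.+1 = (size f).-1 by lia.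
    move/eqP; rewrite mulrn_eq0 -lead_coefE lead_coef_eq0 => /orP[|/eqP f0].
      by move/eqP; lia.
    by rewrite f0 size_poly0 in s1.
  exists `|f.[a]|; first by rewrite normr_gt0 nz // lexx ltW.
  by move=> x /fE->.
have [s us sE] := poly_roots d0.
apply: (@interval_split_ind _ s a b (fun a b =>
  exists2 m : R, 0 < m & forall x, a <= x <= b -> m <= `|f.[x]|)) => //.
  move=> u v w _ au uv vw wb [m m0 mP] [m' m'0 m'P].
  exists (Num.min m m') => [|x /andP[ux xw]]; first by rewrite lt_min m0.
  rewrite ge_min; have [xv|vx] := leP x v; first by rewrite mP ?ux.
  by rewrite m'P ?orbT // xw ltW.
move=> u v au uv vb free.
have nzd x : u < x -> x < v -> f^`().[x] != 0.
  by move=> ux xv; apply/negP; rewrite -[_ == _]/(root _ x) -sE => /free; exact.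
have sgE := sgz_ivt (@IVT_ivt_on _ u v sf).
have nz' x : u <= x -> x <= v -> f.[x] != 0 by move=> ux xv; apply: nz; lra.
exists (Num.min `|f.[u]| `|f.[v]|) => [|x /andP[ux xv]].
  by rewrite lt_min !normr_gt0 !nz' ?lexx ?ltW.
have sv := sgE u v (lexx _) uv (lexx _) nz'.
have sx : sgz f.[u] = sgz f.[x].
  move: ux; rewrite le_eqVlt => /predU1P[-> //|ux].
  by apply: sgE => // t ut tx; apply: nz' => //; lra.
have [p|ng|z] := ltrgt0P f.[u]; last by have := nz' u; rewrite z eqxx lexx ltW // => /(_ isT isT).
  move: sv sx; rewrite gtr0_sgz // => /esym sv /esym sx.
  have pv : 0 < f.[v] by rewrite -sgz_gt0 sv.
  have px : 0 < f.[x] by rewrite -sgz_gt0 sx.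
  by rewrite !gtr0_norm // between_ends_low.
move: sv sx; rewrite ltr0_sgz // => /esym sv /esym sx.
have pv : f.[v] < 0 by rewrite -sgz_lt0 sv.
have px : f.[x] < 0 by rewrite -sgz_lt0 sx.
rewrite !ltr0_norm // -!hornerN between_ends_low // ?size_polyN // => t ut tv.
by rewrite derivN hornerN oppr_eq0 nzd.
Qed.

End LowDegree.

(** * Boundary sums over rectangles *)

Section Rectangles.
Variable R : realFieldType.
Implicit Types (P Q D : {poly {poly R}}) (c : {poly R}) (x y : R).

Lemma specY_swap P y : specY P y = specX (swapXY P) y.
Proof. by rewrite /specY /specX horner_swapXY. Qed.

Lemma horner_specX P x y : (specX P x).[y] = P.[x, y].
Proof. by []. Qed.

Lemma horner_specY P x y : (specY P y).[x] = P.[x, y].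
Proof. by rewrite specY_swap horner_specX horner2_swapXY. Qed.

Lemma specXM P Q x : specX (P * Q) x = specX P x * specX Q x.
Proof. exact: hornerM. Qed.

Lemma specXB P Q x : specX (P - Q) x = specX P x - specX Q x.
Proof. by rewrite /specX !hornerE. Qed.

Lemma specXC c x : specX c%:P x = c.
Proof. by rewrite /specX hornerC. Qed.

Lemma specYM P Q y : specY (P * Q) y = specY P y * specY Q y.
Proof. exact: rmorphM. Qed.

Lemma specYB P Q y : specY (P - Q) y = specY P y - specY Q y.
Proof. exact: rmorphB. Qed.

Lemma specYC c y : specY c%:P y = c.[y]%:P.
Proof. by rewrite /specY map_polyC. Qed.

(** With [Q] the real and [P] the imaginary part this is twice the winding number; general pairs are
    allowed so that it applies along the remainder sequence. *)
Definition edge_sum Q P x0 x1 y0 y1 : rat :=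
  Ind x0 x1 (specY Q y0) (specY P y0)
  + Ind y0 y1 (specX Q x1) (specX P x1)
  + Ind x1 x0 (specY Q y1) (specY P y1)
  + Ind y1 y0 (specX Q x0) (specX P x0).

(** The common edge is traversed in both directions and cancels. *)
Lemma edge_sum_splitX Q P x0 x1 x2 y0 y1 : x0 < x1 -> x1 < x2 ->
  edge_sum Q P x0 x2 y0 y1 = edge_sum Q P x0 x1 y0 y1 + edge_sum Q P x1 x2 y0 y1.
Proof.
move=> h1 h2; rewrite /edge_sum !(Ind_rev _ x0) ?(Ind_rev y0) !(Ind_rev x1 x2).
rewrite !(Ind_rev x0) !(Ind_split _ _ h1 h2); ring.
Qed.

Lemma edge_sum_splitY Q P x0 x1 y0 y1 y2 : y0 < y1 -> y1 < y2 ->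
  edge_sum Q P x0 x1 y0 y2 = edge_sum Q P x0 x1 y0 y1 + edge_sum Q P x0 x1 y1 y2.
Proof.
move=> h1 h2; rewrite /edge_sum !(Ind_rev x0 x1) !(Ind_rev y0 y2).
rewrite !(Ind_rev y0 y1) !(Ind_rev y1 y2) !(Ind_split _ _ h1 h2); ring.
Qed.

Section OneRectangle.
Variables x0 x1 y0 y1 : R.
Hypotheses (hx : x0 < x1) (hy : y0 < y1).

Let x0in : x0 <= x0 <= x1. Proof. by rewrite lexx ltW. Qed.
Let x1in : x0 <= x1 <= x1. Proof. by rewrite lexx ltW. Qed.
Let y0in : y0 <= y0 <= y1. Proof. by rewrite lexx ltW. Qed.
Let y1in : y0 <= y1 <= y1. Proof. by rewrite lexx ltW. Qed.

Let edge_sumE Q P : edge_sum Q P x0 x1 y0 y1 =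
  Ind x0 x1 (specY Q y0) (specY P y0)
  + Ind y0 y1 (specX Q x1) (specX P x1)
  - Ind x0 x1 (specY Q y1) (specY P y1)
  - Ind y0 y1 (specX Q x0) (specX P x0).
Proof. by rewrite /edge_sum (Ind_rev x0 x1) (Ind_rev y0 y1). Qed.

Lemma edge_sum_nopole Q P : (forall x y, x0 <= x <= x1 -> y0 <= y <= y1 ->
  P.[x, y] != 0) -> edge_sum Q P x0 x1 y0 y1 = 0.
Proof.
move=> nz; have hX x y : y0 <= y <= y1 -> Ind x0 x1 (specY Q y) (specY P y) = 0.
  by move=> yin; apply: Ind_noroot => // t tin; rewrite horner_specY nz.
have hY x : x0 <= x <= x1 -> Ind y0 y1 (specX Q x) (specX P x) = 0.
  by move=> xin; apply: Ind_noroot => // t tin; rewrite horner_specX nz.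
by rewrite edge_sumE !hX // !hY // !subr0 addr0.
Qed.

Lemma edge_sum_dvd c D Q P : (forall y, y0 <= y <= y1 -> c.[y] != 0) ->
  c%:P * Q = D * P -> edge_sum Q P x0 x1 y0 y1 = 0.
Proof.
move=> nz E; have hX y : y0 <= y <= y1 -> Ind x0 x1 (specY Q y) (specY P y) = 0.
  move=> yin; apply: (@Ind_dvd _ _ _ (specY c%:P y) (specY D y)) => //.
    by move=> x _; rewrite specYC hornerC nz.
  by rewrite -!specYM E.
have hY x : x0 <= x <= x1 -> Ind y0 y1 (specX Q x) (specX P x) = 0.
  move=> xin; apply: (@Ind_dvd _ _ _ (specX c%:P x) (specX D x)) => //.
    by move=> y; rewrite specXC; exact: nz.
  by rewrite -!specXM E.
by rewrite edge_sumE !hX // !hY // !subr0 addr0.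
Qed.

(** As [c] involves only [Y], it is a positive constant on a horizontal edge and a positive
    polynomial on a vertical one, so [Ind_rem] applies to each edge. *)
Lemma edge_sum_rem c D Q Q' P : (forall y, y0 <= y <= y1 -> 0 < c.[y]) ->
  c%:P * Q = D * P - Q' ->
  edge_sum Q' P x0 x1 y0 y1 = - edge_sum Q P x0 x1 y0 y1.
Proof.
move=> nz E; have hX y : y0 <= y <= y1 ->
    Ind x0 x1 (specY Q' y) (specY P y) = - Ind x0 x1 (specY Q y) (specY P y).
  move=> yin; apply: (@Ind_rem _ _ _ (specY c%:P y) (specY D y)) => //.
    by move=> x _; rewrite specYC hornerC nz.
  by rewrite -!specYM E specYB.
have hY x : x0 <= x <= x1 ->
    Ind y0 y1 (specX Q' x) (specX P x) = - Ind y0 y1 (specX Q x) (specX P x).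
  move=> xin; apply: (@Ind_rem _ _ _ (specX c%:P x) (specX D x)) => //.
    by move=> y; rewrite specXC; exact: nz.
  by rewrite -!specXM E specXB.
by rewrite !edge_sumE !hX // !hY //; ring.
Qed.

Definition edges_ivt P := [/\ ivt_on x0 x1 (specY P y0), ivt_on x0 x1 (specY P y1),
  ivt_on y0 y1 (specX P x0) & ivt_on y0 y1 (specX P x1)].

(* By [Ind_inversion] the sum of both sides is the variation of the sign of
   [P * Q] along the closed boundary. *)
Lemma edge_sum_swap P Q : edges_ivt P -> edges_ivt Q ->
  (forall x y, x0 <= x <= x1 -> y0 <= y <= y1 ->
     ~ (P.[x, y] = 0 /\ Q.[x, y] = 0)) ->
  edge_sum Q P x0 x1 y0 y1 = - edge_sum P Q x0 x1 y0 y1.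
Proof.
move=> [PY0 PY1 PX0 PX1] [QY0 QY1 QX0 QX1] nz.
have hX y : y0 <= y <= y1 -> ivt_on x0 x1 (specY P y) -> ivt_on x0 x1 (specY Q y) ->
  Ind x0 x1 (specY Q y) (specY P y) = half_sgn (specY P y) (specY Q y) x1
    - half_sgn (specY P y) (specY Q y) x0 - Ind x0 x1 (specY P y) (specY Q y).
  move=> yin iP iQ; rewrite -Ind_inversion ?addrK // => x xin.
  by rewrite !horner_specY; apply: nz.
have hY x : x0 <= x <= x1 -> ivt_on y0 y1 (specX P x) -> ivt_on y0 y1 (specX Q x) ->
  Ind y0 y1 (specX Q x) (specX P x) = half_sgn (specX P x) (specX Q x) y1
    - half_sgn (specX P x) (specX Q x) y0 - Ind y0 y1 (specX P x) (specX Q x).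
  move=> xin iP iQ; rewrite -Ind_inversion ?addrK // => y yin.
  by rewrite !horner_specX; apply: nz.
rewrite !edge_sumE !hX // !hY // /half_sgn !horner_specX !horner_specY; ring.
Qed.

End OneRectangle.

Lemma poly2_lipschitzY P (M : R) : exists2 C : R, 0 <= C &
  forall x y y', `|x| <= M -> `|y| <= M -> `|y'| <= M ->
    `|P.[x, y] - P.[x, y']| <= C * `|y - y'|.
Proof.
elim/poly_ind: P => [|P c [C C0 IH]].
  by exists 0 => // x y y' _ _ _; rewrite !horner0 subr0 normr0 mul0r.
have [K K0 cK] := poly_lipschitz c M.
exists (C * `|M| + K) => [|x y y' xM yM yM']; first by rewrite addr_ge0 ?mulr_ge0.
rewrite hornerMXaddC !hornerD !hornerM !hornerC.
have -> : P.[x, y] * x + c.[y] - (P.[x, y'] * x + c.[y']) =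
  (P.[x, y] - P.[x, y']) * x + (c.[y] - c.[y']) by ring.
rewrite (le_trans (ler_normD _ _)) // [leRHS]mulrDl.
have H2 := cK y y' yM yM'.
have H1 : `|(P.[x, y] - P.[x, y']) * x| <= C * `|M| * `|y - y'|.
  rewrite normrM mulrAC ler_pM ?IH //.
  by rewrite (le_trans xM) ?ler_norm.
exact: (lerD H1 H2).
Qed.

End Rectangles.

(** * Thin horizontal strips around a given height *)

Section ThinStrips.
Variables (R : realFieldType) (n : nat) (ivt : IVT R n).
Implicit Types (P Q : {poly {poly R}}) (a b x y : R).

Definition low_degree P := forall t : R,
  (size (specX P t) <= n.+1)%N /\ (size (specY P t) <= n.+1)%N.

Lemma low_degree_edges P x0 x1 y0 y1 : low_degree P -> edges_ivt x0 x1 y0 y1 P.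
Proof.
move=> dP; have [sx0 _] := dP x0; have [sx1 _] := dP x1.
have [_ sy0] := dP y0; have [_ sy1] := dP y1.
by split; apply: (IVT_ivt_on ivt).
Qed.

Lemma nonvanishing_near P a b ys : low_degree P -> a < b ->
  (forall x, a <= x <= b -> P.[x, ys] != 0) ->
  exists2 e : R, 0 < e & forall x y, a <= x <= b -> `|y - ys| <= e ->
    P.[x, y] != 0.
Proof.
move=> dP ab nz.
have [m m0 mP] : exists2 m : R, 0 < m &
    forall x, a <= x <= b -> m <= `|(specY P ys).[x]|.
  apply: (nonvanishing_bounded_below ivt) => // [|x xab].
    by have [] := dP ys.
  by rewrite horner_specY nz.
pose M := `|a| + `|b| + `|ys| + 1.
have [C C0 lip] := poly2_lipschitzY P M.
have C1 : 0 < C + 1 by lra.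
(* In this range [P] moves by at most [m / 2] from its value at height [ys]; the cap 1 keeps [y]
   within [M]. *)
exists (Num.min 1 (m / (C + 1) / 2)) => [|x y xab].
  by rewrite lt_min ltr01 /= !divr_gt0.
rewrite le_min => /andP[y1]; rewrite ler_pdivlMr // ler_pdivlMr // => yC.
have xM : `|x| <= M.
  have := ler_norm b; have := ler_normr; case/andP: xab => ax xb.
  have := lerNnormlW (lexx `|a|); have := normr_ge0 ys; have := normr_ge0 a.
  by have := normr_ge0 b; rewrite ler_norml /M; lra.
have yM : `|y| <= M.
  have := ler_normD (y - ys) ys; rewrite subrK /M.
  by have := normr_ge0 a; have := normr_ge0 b; lra.
have ysM : `|ys| <= M.
  by rewrite /M; have := normr_ge0 a; have := normr_ge0 b; lra.
have L := lip x y ys xM yM ysM.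
have mx := mP x xab; rewrite horner_specY in mx.
apply/eqP => Pxy; rewrite Pxy sub0r normrN in L.
have dy : 0 <= `|y - ys| by [].
by move: L yC mx dy m0 C0; move: `|P.[x, ys]| `|y - ys| => p q; nra.
Qed.

(* One of [P], [Q] is nonvanishing on each piece of a suitable subdivision of
   [x0, x1], and then also on the product of that piece with a small interval. *)
Lemma edge_sum_thin P Q x0 x1 ys : low_degree P -> low_degree Q -> x0 < x1 ->
  (forall x, x0 <= x <= x1 -> ~ (P.[x, ys] = 0 /\ Q.[x, ys] = 0)) ->
  exists2 e : R, 0 < e & forall y0 y1, y0 < y1 -> `|y0 - ys| <= e ->
    `|y1 - ys| <= e -> edge_sum Q P x0 x1 y0 y1 = 0.
Proof.
move=> dP dQ hx nz.
pose Phi a b := exists2 e : R, 0 < e & forall y0 y1, y0 < y1 -> `|y0 - ys| <= e ->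
    `|y1 - ys| <= e -> edge_sum Q P a b y0 y1 = 0.
rewrite -/(Phi x0 x1).
have ynear e y0 y1 y : `|y0 - ys| <= e -> `|y1 - ys| <= e -> y0 <= y <= y1 ->
    `|y - ys| <= e.
  by rewrite !ler_norml; lra.
have onP a b : a < b -> (forall x, a <= x <= b -> P.[x, ys] != 0) -> Phi a b.
  move=> ab /(nonvanishing_near dP ab)[e e0 H]; exists e => // y0 y1 y01 h0 h1.
  by apply: edge_sum_nopole => // x y xab yin; apply: H => //; apply: ynear yin.
have onQ a b : a < b -> (forall x, a <= x <= b -> Q.[x, ys] != 0) -> Phi a b.
  move=> ab /(nonvanishing_near dQ ab)[e e0 H]; exists e => // y0 y1 y01 h0 h1.
  have nzQ x y : a <= x <= b -> y0 <= y <= y1 -> Q.[x, y] != 0.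
    by move=> xab yin; apply: H => //; apply: ynear yin.
  rewrite edge_sum_swap ?edge_sum_nopole ?oppr0 //; try exact: low_degree_edges.
  by move=> x y xab yin [_ Q0]; have := nzQ x y xab yin; rewrite Q0 eqxx.
have add a b c : a < b -> b < c -> Phi a b -> Phi b c -> Phi a c.
  move=> ab bc [e e0 H] [e' e'0 H']; exists (Num.min e e') => [|y0 y1 y01].
    by rewrite lt_min e0.
  rewrite !le_min => /andP[? ?] /andP[? ?].
  by rewrite (edge_sum_splitX _ _ _ _ ab bc) H ?H' ?addr0.
(* A slice that vanishes identically has no finite root list; the other polynomial is then nonzero
   on all of [[x0, x1]] at this height. *)
have [P0|P0] := eqVneq (specY P ys) 0.
  apply: onQ => // x xin; apply/eqP => Q0; apply: (nz x xin); split=> //.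
  by rewrite -horner_specY P0 horner0.
have [Q0|Q0] := eqVneq (specY Q ys) 0.
  apply: onP => // x xin; apply/eqP => P0'; apply: (nz x xin); split=> //.
  by rewrite -horner_specY Q0 horner0.
have [s us sE] := poly_roots (mulf_neq0 P0 Q0).
apply: (@interval_split_ind _ s x0 x1 Phi) => //.
  by move=> a b c _ _ ab bc _; apply: add.
move=> a b xa ab bx free.
have nzPQ x : a < x -> x < b -> (P.[x, ys] != 0) && (Q.[x, ys] != 0).
  move=> ax xb; apply: contrapT => H; apply: (free x) => //.
  by rewrite sE rootM !rootE !horner_specY; move: H; case: eqP; case: eqP.
(* Different polynomials may vanish at [a] and at [b]; each half of the interval uses one that is
   nonzero at its outer end. *)
pose m := (a + b) / 2.
have am : a < m by rewrite /m; lra.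
have mb : m < b by rewrite /m; lra.
apply: (add a m b) => //.
  have [Pa|Pa] := eqVneq P.[a, ys] 0; [apply: onQ|apply: onP] => // x /andP[ax xm];
    move: ax; rewrite le_eqVlt => /predU1P[<-|ax] //.
  - by apply/eqP => Qa; apply: (nz a) => //; rewrite xa; lra.
  - by have /andP[] : _ && _ := nzPQ x ax (le_lt_trans xm mb).
  - by have /andP[] : _ && _ := nzPQ x ax (le_lt_trans xm mb).
have [Pb|Pb] := eqVneq P.[b, ys] 0; [apply: onQ|apply: onP] => // x /andP[mx xb];
  move: xb; rewrite le_eqVlt => /predU1P[->|xb] //.
- by apply/eqP => Qb; apply: (nz b) => //; rewrite bx andbT; lra.
- by have /andP[] : _ && _ := nzPQ x (lt_le_trans am mx) xb.
- by have /andP[] : _ && _ := nzPQ x (lt_le_trans am mx) xb.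
Qed.

End ThinStrips.

(** * Subresultants *)

Section Subresultant.
Variable A : idomainType.
Implicit Types (P Q S T D U V : {poly A}) (c : A) (j : nat).

(* Nonvanishing of the [j]-th principal subresultant coefficient of [P], [Q]. *)
Definition nondegenerate P Q j := forall U V,
  (size U <= (size Q).-1 - j)%N -> (size V <= (size P).-1 - j)%N ->
  (size (U * P + V * Q)%R <= j)%N -> U = 0 /\ V = 0.

Lemma nondegenerate_last P Q : Q != 0 -> nondegenerate P Q (size Q).-1.
Proof.
move=> Q0 U V; rewrite subnn size_poly_leq0 => /eqP-> _; rewrite mul0r add0r.
have [->//|V0] := eqVneq V 0; rewrite size_mul //.
by move: Q0 V0; rewrite -!size_poly_gt0; lia.
Qed.

(** Through [c *: S = D * T - Q], a combination [U * S + V * T], once scaled by [c], becomes the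
    combination [W * T - U * Q] of [T] and [Q]. *)
Lemma nondegenerate_step c D S T Q j : c != 0 -> Q != 0 ->
  c *: S = D * T - Q -> (size Q < size T)%N -> (j <= (size Q).-1)%N ->
  nondegenerate T Q j -> nondegenerate S T j.
Proof.
move=> c0 Q0 E QT jQ H U V sU sV sC.
have QgT : (0 < size Q)%N by rewrite size_poly_gt0.
pose W := U * D + c *: V.
have WE : W * T = c *: (U * S + V * T) + U * Q.
  rewrite /W scalerDr mulrDl -scalerAl [c *: (U * S)]scalerAr E; ring.
have sW : (size W <= (size Q).-1 - j)%N.
  have [->|W0] := eqVneq W 0; first by rewrite size_poly0.
  have T0 : T != 0 by rewrite -size_poly_gt0; lia.
  (* The size of [W] is read off from [W * T], as the two summands of [W] may be larger. *)
  have sWT : (size (W * T)%R <= maxn j (size U + size Q).-1)%N.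
    rewrite WE (leq_trans (size_polyD _ _)) // size_scale // geq_max.
    by rewrite !leq_max sC size_polyMleq orbT.
  by move: sWT; rewrite size_mul //; move: W0; rewrite -size_poly_gt0; lia.
have [||W0 U0] := H W (- U) sW; rewrite ?size_polyN //.
  have -> : W * T + - U * Q = c *: (U * S + V * T) by rewrite WE; ring.
  by rewrite size_scale.
move/eqP: U0; rewrite oppr_eq0 => /eqP U0; split=> //.
move/eqP: W0; rewrite /W U0 mul0r add0r scale_poly_eq0 (negPf c0) /=.
by move/eqP.
Qed.

Section Matrix.
Variables (P Q : {poly A}) (j : nat).
Let N := ((size Q).-1 - j)%N.
Let M := ((size P).-1 - j)%N.
Hypotheses (jP : (j <= (size P).-1)%N) (jQ : (j <= (size Q).-1)%N).
Hypotheses (P0 : P != 0) (Q0 : Q != 0).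

Definition row_poly (i : 'I_(N + M)) : {poly A} :=
  match fintype.split i with inl a => 'X^a * P | inr b => 'X^b * Q end.

(** Up to the order of rows and columns, the block of the Sylvester matrix whose determinant is the
    [j]-th principal subresultant coefficient. *)
Definition subres_mx : 'M[A]_(N + M) := \matrix_(i, l) (row_poly i)`_(j + l).

Definition comb (v : 'rV[A]_(N + M)) : {poly A} := \sum_i v 0 i *: row_poly i.

Lemma mul_subres_mx v l : (v *m subres_mx) 0 l = (comb v)`_(j + l).
Proof.
by rewrite mxE /comb coef_sum; apply: eq_bigr => i _; rewrite mxE coefZ.
Qed.

Lemma combE v :
  comb v = rVpoly (lsubmx v) * P + rVpoly (rsubmx v) * Q.
Proof.
have rE m (u : 'rV[A]_m) : rVpoly u = \sum_i u 0 i *: 'X^i.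
  rewrite {1}[u]row_sum_delta linear_sum; apply: eq_bigr => i _.
  by rewrite linearZ /= rVpoly_delta.
rewrite !rE !mulr_suml /comb big_split_ord /=; congr (_ + _);
  apply: eq_bigr => i _; rewrite -scalerAl mxE /row_poly.
  by rewrite (unsplitK (inl i : 'I_N + 'I_M)).
by rewrite (unsplitK (inr i : 'I_N + 'I_M)).
Qed.

Lemma size_comb v : (size (comb v) <= j + (N + M))%N.
Proof.
have size_rV m (u : 'rV[A]_m) : (size (rVpoly u) <= m)%N by exact: size_poly.
have sU := size_rV _ (lsubmx v); have sV := size_rV _ (rsubmx v).
rewrite combE (leq_trans (size_polyD _ _)) // geq_max.
have gP : (0 < size P)%N by rewrite size_poly_gt0.
have gQ : (0 < size Q)%N by rewrite size_poly_gt0.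
by rewrite !(leq_trans (size_polyMleq _ _)) //; move: sU sV; rewrite /N /M; lia.
Qed.

(** A vector in the left kernel yields a combination whose coefficients from index [j] on vanish. *)
Lemma det_subres_neq0 : nondegenerate P Q j -> \det subres_mx != 0.
Proof.
move=> H; apply/det0P => -[v v0 vM].
have sj : (size (comb v) <= j)%N.
  apply/leq_sizeP => k jk; have [ks|ks] := ltnP k (j + (N + M)); last first.
    by apply/leq_sizeP: ks; apply: size_comb.
  have kl : (k - j < N + M)%N by lia.
  have := congr1 (fun w : 'rV_(N + M) => w 0 (Ordinal kl)) vM.
  by rewrite mul_subres_mx mxE /= subnKC.
move: sj; rewrite combE => /H[||Z1 Z2]; rewrite ?size_poly //.
move/eqP: v0; apply; rewrite -[v]hsubmxK.
by rewrite -[lsubmx v]rVpolyK -[rsubmx v]rVpolyK Z1 Z2 !linear0 row_mx0.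
Qed.

(** Since [T] has size at most [j + 1], the matrix sends the coefficients of [U] and [V] to a vector
    whose only possibly nonzero entry is [T_j]; the adjugate then solves for [V] and for [T]. *)
Lemma subres_cramer (c0 : 'I_(N + M)) U V (T := U * P + V * Q) :
  c0 = 0%N :> nat ->
  (size U <= N)%N -> (size V <= M)%N -> (size T <= j.+1)%N ->
  \det subres_mx *: T = T`_j *: comb (row c0 (\adj subres_mx)) /\
  (forall k (km : (k < M)%N), \det subres_mx * V`_k =
     T`_j * (\adj subres_mx) c0 (rshift N (Ordinal km))).
Proof.
move=> c00 sU sV sT; pose v := row_mx (poly_rV U : 'rV_N) (poly_rV V : 'rV_M).
have vT : comb v = T.
  by rewrite combE row_mxKl row_mxKr !poly_rV_K.
have vM : v *m subres_mx = T`_j *: delta_mx 0 c0.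
  apply/rowP => l; rewrite mul_subres_mx vT !mxE eqxx /=.
  have [->|lc] := eqVneq l c0; first by rewrite c00 addn0 mulr1.
  rewrite mulr0; move/leq_sizeP: sT; apply.
  have : (l != c0 :> nat) by [].
  by rewrite c00; lia.
have key : \det subres_mx *: v = T`_j *: row c0 (\adj subres_mx).
  by rewrite rowE scalemxAl -vM -mulmxA mul_mx_adj mul_mx_scalar.
have combZ a u : comb (a *: u) = a *: comb u.
  by rewrite /comb scaler_sumr; apply: eq_bigr => i _; rewrite mxE scalerA.
split; first by rewrite -combZ -key combZ vT.
move=> k km; have := congr1 (fun w : 'rV_(N + M) => w 0 (rshift N (Ordinal km))) key.
by rewrite mxE /v row_mxEr mxE => ->; rewrite mxE [row _ _ _ _]mxE.
Qed.

End Matrix.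
End Subresultant.

(** * Weighted degrees of determinants *)

Section WeightedDegree.
Variable A : idomainType.
Implicit Types (f g : {poly A}).

(** Models a coefficient of [X^c] in a polynomial of total degree at most [r]; the zero polynomial
    qualifies even if [r < c]. *)
Definition wdeg (c r : nat) f := f != 0 -> ((size f).-1 + c <= r)%N.

Lemma wdegD c r f g : wdeg c r f -> wdeg c r g -> wdeg c r (f + g).
Proof.
have [->|f0] := eqVneq f 0; first by rewrite add0r.
have [->|g0] := eqVneq g 0; first by rewrite addr0.
move=> /(_ f0) Hf /(_ g0) Hg _; have := size_polyD f g.
by move: f0 g0; rewrite -!size_poly_gt0; lia.
Qed.

Lemma wdegM c r c' r' f g : wdeg c r f -> wdeg c' r' g ->
  wdeg (c + c') (r + r') (f * g).
Proof.
rewrite /wdeg mulf_eq0 negb_or => Hf Hg /andP[f0 g0].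
move: (Hf f0) (Hg g0); rewrite size_mul //.
by move: f0 g0; rewrite -!size_poly_gt0; lia.
Qed.

Lemma wdeg_sign c r (b : nat) f : wdeg c r f -> wdeg c r ((-1) ^+ b * f).
Proof.
by rewrite /wdeg -signr_odd; case: odd; rewrite ?mulN1r ?mul1r ?oppr_eq0 ?size_polyN.
Qed.

Lemma wdeg_sum I (s : seq I) (p : pred I) c r (F : I -> {poly A}) :
  (forall i, p i -> wdeg c r (F i)) -> wdeg c r (\sum_(i <- s | p i) F i).
Proof.
move=> H; apply: (big_ind (wdeg c r)) => //; last exact: wdegD.
by rewrite /wdeg eqxx.
Qed.

Lemma wdeg_prod I (s : seq I) (c r : I -> nat) (F : I -> {poly A}) :
  (forall i, wdeg (c i) (r i) (F i)) ->
  wdeg (\sum_(i <- s) c i) (\sum_(i <- s) r i) (\prod_(i <- s) F i).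
Proof.
move=> H; elim: s => [|i s IH]; first by rewrite !big_nil /wdeg size_poly1.
by rewrite !big_cons; apply: wdegM.
Qed.

(** Each term of the Leibniz expansion uses every row and every column once. *)
Lemma wdeg_det n (M : 'M[{poly A}]_n) (c r : 'I_n -> nat) :
  (forall i l, wdeg (c l) (r i) (M i l)) ->
  wdeg (\sum_l c l) (\sum_i r i) (\det M).
Proof.
move=> H; rewrite /determinant; apply: wdeg_sum => s _; apply: wdeg_sign.
rewrite (reindex_inj (@perm_inj _ s)) /=; exact: wdeg_prod.
Qed.

Lemma wdeg_adj n (M : 'M[{poly A}]_n) (c r : 'I_n -> nat) i l :
  (forall i l, wdeg (c l) (r i) (M i l)) ->
  wdeg (\sum_(k < n | k != l) c k) (\sum_(k < n | k != i) r k) ((\adj M) l i).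
Proof.
move=> H; rewrite mxE /cofactor; apply: wdeg_sign.
have big_lift (k : 'I_n) (F : 'I_n -> nat) :
    \sum_(t < n | t != k) F t = \sum_(t < n.-1) F (lift k t).
  have := @bigD1_ord _ addn 0 _ k xpredT F isT.
  by rewrite (bigD1 k) //= => /addnI.
rewrite !big_lift; apply: wdeg_det => a b; rewrite !mxE; exact: H.
Qed.

End WeightedDegree.

(** * Degree bounds for subresultants *)

Section SubresultantDegree.
Variables (R : realFieldType) (d : nat).
Implicit Types (P Q : {poly {poly R}}) (j : nat).

Definition total_bound P := forall k, wdeg k d P`_k.

Lemma total_bound_size P : total_bound P -> (size P <= d.+1)%N.
Proof.
move=> H; have [->|P0] := eqVneq P 0; first by rewrite size_poly0.
have := H (size P).-1; rewrite -lead_coefE /wdeg lead_coef_eq0 => /(_ P0).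
by move: P0; rewrite -size_poly_gt0; lia.
Qed.

Lemma total_bound_specX P x : total_bound P -> (size (specX P x) <= d.+1)%N.
Proof.
move=> H; rewrite /specX horner_coef (leq_trans (size_sum _ _ _)) //.
apply/bigmax_leqP => k _; rewrite -polyC_exp mulrC mul_polyC.
rewrite (leq_trans (size_scale_leq _ _)) //.
have [->|Pk] := eqVneq P`_k 0; first by rewrite size_poly0.
by rewrite (leq_trans (leqSpred _)) // ltnS (leq_trans _ (H k Pk)) // leq_addr.
Qed.

Lemma total_bound_specY P y : total_bound P -> (size (specY P y) <= d.+1)%N.
Proof.
by move=> H; rewrite (leq_trans (size_poly _ _)) // total_bound_size.
Qed.

Lemma double_sum_shift k n :
  (2 * (\sum_(a < n) (k + a)) + n = 2 * k * n + n * n)%N.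
Proof.
elim: n => [|n IH]; first by rewrite big_ord0 !muln0.
by rewrite big_ord_recr /=; move: (\sum_(i < n) (k + i))%N IH => s; nia.
Qed.

Section Pair.
Variables (P Q : {poly {poly R}}) (j : nat).
Hypotheses (dP : total_bound P) (dQ : total_bound Q).
Hypotheses (P0 : P != 0) (Q0 : Q != 0).
Hypotheses (jP : (j < (size P).-1)%N) (jQ : (j <= (size Q).-1)%N).
Let N := ((size Q).-1 - j)%N.
Let M := ((size P).-1 - j)%N.

Let r (i : 'I_(N + M)) : nat :=
  match fintype.split i with inl a => (d + a)%N | inr b => (d + b)%N end.
Let c (l : 'I_(N + M)) := (j + l)%N.

Let wdeg_entry i l : wdeg (c l) (r i) (subres_mx P Q j i l).
Proof.
rewrite mxE /row_poly /r /c; case: fintype.split => a; rewrite coefXnM;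
  (case: ltnP => al; first by rewrite /wdeg eqxx).
  by move=> nz; rewrite (leq_trans _ (leq_add (dP nz) (leqnn a))) // -addnA subnK.
by move=> nz; rewrite (leq_trans _ (leq_add (dQ nz) (leqnn a))) // -addnA subnK.
Qed.

Let r_ge i : (d <= r i)%N.
Proof. by rewrite /r; case: fintype.split => a; apply: leq_addr. Qed.

(** With [D = d - j], [m = D - M] and [n = D - N], the row weights exceed the sum of all column
    weights by [D M + D N - M N = D^2 - m n]; omitting column [c0] adds [j], and
    [D^2 + j <= d^2]. *)
Let weights (c0 : 'I_(N + M)) : c0 = 0%N :> nat ->
  (\sum_i r i <= d ^ 2 + \sum_(l < N + M | l != c0) c l)%N.
Proof.
move=> c00.
have rE : (\sum_i r i = \sum_(a < N) (d + a) + \sum_(b < M) (d + b))%N.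
  rewrite big_split_ord /=; congr (_ + _)%N; apply: eq_bigr => a _; rewrite /r.
    by rewrite (unsplitK (inl a : 'I_N + 'I_M)).
  by rewrite (unsplitK (inr a : 'I_N + 'I_M)).
have cE : (j + \sum_(l < N + M | l != c0) c l = \sum_(l < N + M) (j + l))%N.
  by rewrite [RHS](bigD1 c0) //= c00 addn0.
have := double_sum_shift d N; have := double_sum_shift d M.
have := double_sum_shift j (N + M).
rewrite rE -cE.
move: (\sum_(a < N) _)%N (\sum_(a < M) _)%N (\sum_(l < _ | _) _)%N => s1 s2 s3.
have sP := total_bound_size dP; have sQ := total_bound_size dQ.
have [D dE] : exists D, d = (j + D)%N by exists (d - j)%N; lia.
have [m DM] : exists m, D = (M + m)%N by exists (D - M)%N; rewrite /M; lia.
have [n DN] : exists n, D = (N + n)%N by exists (D - N)%N; rewrite /N; lia.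
have j2 : (j <= j * j)%N by case: (posnP j) => [->|j0] //; rewrite leq_pmull.
move: N M DM DN => N' M' DM DN.
have e1 : (D * D + M' * N' = m * n + D * M' + D * N')%N.
  have : ((M' + m) * (N' + n) + M' * N' = m * n + (N' + n) * M' + (M' + m) * N')%N by lia.
  by rewrite -DM -DN.
have e2 : (d ^ 2 = j * j + 2 * (j * D) + D * D)%N by rewrite dE expnS expn1; lia.
have -> : (2 * d * M' = 2 * (j * M') + 2 * (D * M'))%N by rewrite dE; lia.
have -> : (2 * d * N' = 2 * (j * N') + 2 * (D * N'))%N by rewrite dE; lia.
have -> : (2 * j * (N' + M') = 2 * (j * N') + 2 * (j * M'))%N by lia.
have -> : ((N' + M') * (N' + M') = N' * N' + M' * M' + 2 * (M' * N'))%N by lia.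
by rewrite e2; lia.
Qed.

Lemma size_det_subres : (size (\det (subres_mx P Q j)) <= (d ^ 2).+1)%N.
Proof.
have n0 : (0 < N + M)%N by rewrite /M; lia.
have [->|D0] := eqVneq (\det (subres_mx P Q j)) 0; first by rewrite size_poly0.
rewrite (leq_trans (leqSpred _)) // ltnS.
have H := leq_trans (wdeg_det wdeg_entry D0) (weights (c0 := Ordinal n0) erefl).
rewrite -(leq_add2r (\sum_(l < N + M | l != Ordinal n0) c l)) (leq_trans _ H) //.
by rewrite leq_add2l [leqRHS](bigD1 (Ordinal n0)) //= leq_addl.
Qed.

(** Deleting row [i], whose weight is at least [d], saves [d]; this makes room for the specialized
    row polynomial in [size_comb_adj]. *)
Lemma size_adj_subres (c0 i : 'I_(N + M)) : c0 = 0%N :> nat ->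
  (size ((\adj (subres_mx P Q j)) c0 i) + d <= (d ^ 2).+1)%N
  \/ (\adj (subres_mx P Q j)) c0 i = 0.
Proof.
move=> c00; have [->|D0] := eqVneq ((\adj (subres_mx P Q j)) c0 i) 0; first by right.
left; have H := wdeg_adj wdeg_entry D0; have W := weights c00.
rewrite (bigD1 i) //= in W.
have {}H := leq_trans (leq_add (r_ge i) H) W.
rewrite (leq_trans (leq_add (leqSpred _) (leqnn d))) // addSn ltnS.
by rewrite addnC -(leq_add2r (\sum_(l < N + M | l != c0) c l)) -addnA.
Qed.

Lemma size_comb_adj (c0 : 'I_(N + M)) x : c0 = 0%N :> nat ->
  (size (specX (comb (row c0 (\adj (subres_mx P Q j)))) x) <= (d ^ 2).+1)%N.
Proof.
move=> c00; rewrite /specX /comb horner_sum (leq_trans (size_sum _ _ _)) //.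
apply/bigmax_leqP => i _; rewrite hornerZ [row _ _ _ _]mxE.
have [sa|->] := size_adj_subres i c00; last by rewrite mul0r size_poly0.
rewrite (leq_trans (size_polyMleq _ _)) // (leq_trans _ sa) //.
rewrite -subn1 leq_subLR add1n -addnS leq_add2l.
rewrite /row_poly; case: fintype.split => a; rewrite hornerM hornerXn -polyC_exp mul_polyC;
  by rewrite (leq_trans (size_scale_leq _ _)) // total_bound_specX.
Qed.

End Pair.
End SubresultantDegree.

(** * Signs and intermediate values off finitely many points *)

Section Tame.
Variable R : realFieldType.
Implicit Types (f g h : {poly R}) (z : seq R) (u v x y : R).

Definition avoids z u v := forall x, x \in z -> u <= x -> x <= v -> False.

Lemma avoidsS z z' u v u' v' : {subset z' <= z} -> u <= u' -> v' <= v ->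
  avoids z u v -> avoids z' u' v'.
Proof. by move=> zz uu vv H x /zz/H Hx ux xv; apply: Hx; lra. Qed.

Lemma avoids_cat z z' u v : avoids (z ++ z') u v -> avoids z u v /\ avoids z' u v.
Proof.
by move=> H; split; apply: avoidsS H => // x xz; rewrite mem_cat xz ?orbT.
Qed.

(** Holds for nonzero polynomials under the degree bound of [IVT] and passes to products and exact
    quotients, so it reaches leading coefficients of larger degree. *)
Definition tame f := f != 0 /\ exists z, forall u v, u < v -> avoids z u v ->
  0 < f.[u] * f.[v].

Lemma tame_low n f : IVT R n -> f != 0 -> (size f <= n.+1)%N -> tame f.
Proof.
move=> ivt f0 sf; split=> //; have [z _ zE] := poly_roots f0.
exists z => u v uv zuv; have nz x : u <= x -> x <= v -> f.[x] != 0.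
  by move=> ux xv; apply/negP; rewrite -[_ == _]/(root _ _) -zE => /zuv; apply.
have := sgz_ivt (@IVT_ivt_on _ _ ivt f u v sf) (lexx u) uv (lexx v) nz.
have nu := nz u (lexx _) (ltW uv); rewrite -sgz_gt0 sgzM => <-.
by rewrite -expr2 -sgzX sgz_gt0 exprn_even_gt0.
Qed.

Lemma tame1 : tame 1.
Proof. by split; [exact: oner_neq0|exists [::] => u v _ _; rewrite !hornerE]. Qed.

Lemma tameM f g : tame f -> tame g -> tame (f * g).
Proof.
move=> [f0 [z Hz]] [g0 [z' Hz']]; split; first exact: mulf_neq0.
exists (z ++ z') => u v uv /avoids_cat[zuv z'uv]; rewrite !hornerM mulrACA.
by rewrite mulr_gt0 ?Hz ?Hz'.
Qed.

Lemma tameX f n : tame f -> tame (f ^+ n).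
Proof.
by move=> tf; elim: n => [|n IH]; rewrite ?exprS; [exact: tame1|exact: tameM].
Qed.

Lemma tame_div f g : tame (f * g) -> tame g -> tame f.
Proof.
move=> [fg0 [z Hz]] [g0 [z' Hz']]; split.
  by apply: contraNneq fg0 => ->; rewrite mul0r.
exists (z ++ z') => u v uv /avoids_cat[zuv z'uv].
have := Hz u v uv zuv; rewrite !hornerM mulrACA pmulr_lgt0 //; exact: Hz'.
Qed.

Lemma avoids_nonzero f z : (forall u v, u < v -> avoids z u v -> 0 < f.[u] * f.[v]) ->
  forall u v y, u < v -> avoids z u v -> u <= y <= v -> f.[y] != 0.
Proof.
move=> H u v y uv zuv /andP[uy yv]; apply/eqP => fy.
move: uy; rewrite le_eqVlt => /predU1P[uy|uy].
  by have := H u v uv zuv; rewrite uy fy mul0r ltxx.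
have := H u y uy; rewrite fy mulr0 ltxx => /(_ _)/notF; apply.
by apply: avoidsS zuv.
Qed.

Implicit Types S T : {poly {poly R}}.

Definition eventually_ivt S := exists z, forall x u v, u < v -> avoids z u v ->
  ivt_on u v (specX S x).

Lemma eventually_ivt_low n S : IVT R n ->
  (forall x, (size (specX S x) <= n.+1)%N) -> eventually_ivt S.
Proof. by move=> ivt sS; exists [::] => x u v _ _; apply: (IVT_ivt_on ivt). Qed.

(** Where [f] and [g] keep their signs, a sign change of [S] is one of [T], and a zero of [T] is one
    of [S]. *)
Lemma eventually_ivt_prop f g S T : tame f -> tame g -> f *: S = g *: T ->
  eventually_ivt T -> eventually_ivt S.
Proof.
move=> [f0 [z Hz]] [g0 [z' Hz']] E [z'' Hz''].
have E' x y : f.[y] * (specX S x).[y] = g.[y] * (specX T x).[y].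
  have := congr1 (fun p : {poly {poly R}} => (specX p x).[y]) E.
  by rewrite /specX !hornerZ !hornerM.
exists (z ++ (z' ++ z'')) => x u v uv /avoids_cat[zuv /avoids_cat[z'uv z''uv]].
move=> s t us st tv neg.
have av w : avoids w u v -> avoids w s t by apply: avoidsS.
have fst := Hz s t st (av _ zuv); have gst := Hz' s t st (av _ z'uv).
have [c cst Tc] : exists2 c, s < c < t & (specX T x).[c] = 0.
  apply: (Hz'' x u v) => //.
  have : 0 < (g.[s] * g.[t]) * - ((specX T x).[s] * (specX T x).[t]).
    have -> : g.[s] * g.[t] * - ((specX T x).[s] * (specX T x).[t]) =
      - ((g.[s] * (specX T x).[s]) * (g.[t] * (specX T x).[t])) by ring.
    rewrite -!E'.
    have -> : - (f.[s] * (specX S x).[s] * (f.[t] * (specX S x).[t])) =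
      (f.[s] * f.[t]) * - ((specX S x).[s] * (specX S x).[t]) by ring.
    by rewrite mulr_gt0 // oppr_gt0.
  by rewrite pmulr_rgt0 // oppr_gt0.
exists c => //; apply/eqP; have := E' x c; rewrite Tc mulr0 => /eqP.
rewrite mulf_eq0 (negPf (avoids_nonzero Hz st (av _ zuv) _)) //.
by case/andP: cst => sc ct; rewrite !ltW.
Qed.

End Tame.

(** * Signed pseudo-remainder sequences *)

(* The abstraction identifies sizes that differ only by canonical instances,
   which [lia] would treat as distinct atoms. *)
Ltac size_lia :=
  repeat match goal with
  | H : is_true (leq _ _) |- _ => revert H
  | H : @eq nat _ _ |- _ => revert H
  end;
  repeat match goal with
  | |- context [size (polyseq ?p)] => let n := fresh "n" in move: (size (polyseq p)) => n
  end; lia.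

(** The usual identity is multiplied once more by its multiplier: the resulting even power is
    positive wherever the leading coefficient of [T] specializes to a nonzero value. *)
Lemma signed_pseudo_division (A : idomainType) (S T : {poly A}) : T != 0 ->
  (size T <= size S)%N -> exists (e : nat) (K U : {poly A}),
  [/\ lead_coef T ^+ (2 * e) *: S = K * T - U, (size U < size T)%N,
      size K = (size S - size T).+1
    & lead_coef K * lead_coef T = lead_coef T ^+ (2 * e) * lead_coef S].
Proof.
move=> T0 TS; pose c := lead_coef T ^+ scalp S T.
have c0 : c != 0 by rewrite expf_neq0 ?lead_coef_eq0.
have E : (c * c) *: S = (c *: (S %/ T)) * T - - (c *: (S %% T)).
  by rewrite opprK -scalerA Pdiv.Idomain.divp_eq scalerDr scalerAl.
have sU : (size (- (c *: (S %% T)))%R < size T)%N.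
  by rewrite size_polyN size_scale // ltn_modp.
have cE : lead_coef T ^+ (2 * scalp S T) = c * c by rewrite mulnC exprM expr2.
exists (scalp S T), (c *: (S %/ T)), (- (c *: (S %% T))); rewrite cE.
move: (c *: (S %/ T)) (- (c *: (S %% T))) E sU => K U E sU.
have KT : K * T = (c * c) *: S + U by rewrite E subrK.
have cc0 : c * c != 0 by rewrite mulf_neq0.
have ltU : (size U < size ((c * c) *: S))%N.
  by rewrite size_scale // (leq_trans sU).
split=> //; last by rewrite -lead_coefM KT lead_coefDl // lead_coefZ.
have K0 : K != 0.
  apply: contraTneq sU => KE; have := KT; rewrite KE mul0r => /eqP.
  rewrite eq_sym addrC addr_eq0 => /eqP->.
  by rewrite size_polyN size_scale // -leqNgt.
have : size (K * T) = size S by rewrite KT size_polyDl // size_scale.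
by move: K0 T0; rewrite -!size_poly_gt0 => K0 T0; rewrite size_mul -?size_poly_gt0 //; size_lia.
Qed.

Section RemainderSequence.
Variables (R : realFieldType) (d : nat) (ivt : IVT R (d ^ 2)).
Variables (P Q : {poly {poly R}}).
Hypotheses (dP : total_bound d P) (dQ : total_bound d Q).
Hypotheses (Q0 : Q != 0) (sQP : (size Q < size P)%N).

(* [S], [T] are consecutive terms of the signed pseudo-remainder sequence of
   [P], [Q], and [A], [B], [C], [D] are their Bezout cofactors. *)
Record remainder_state (S T A B C D : {poly {poly R}}) : Prop := {
  bezoutS : S = A * P + B * Q;
  bezoutT : T = C * P + D * Q;
  neq0T : T != 0;
  size_TS : (size T < size S)%N;
  size_SP : (size S <= size P)%N;
  size_TQ : (size T <= size Q)%N;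
  size_A : (size A <= (size Q).+1 - size T)%N;
  size_C : (size C <= (size Q).+1 - size S)%N;
  size_D : (size D + size S = (size P).+1)%N;
  size_BD : (size B <= size D)%N;
  tame_S : tame (lead_coef S);
  tame_D : tame (lead_coef D);
  ivt_S : eventually_ivt S;
  nondegenerateST : forall j, (j <= (size T).-1)%N ->
    nondegenerate S T j -> nondegenerate P Q j }.

Lemma dividend_neq0 : P != 0.
Proof. by rewrite -size_poly_gt0 (leq_trans _ sQP). Qed.

(* Cramer's rule expresses [T] and [lead_coef D] through minors of degree at
   most [d ^ 2]. *)
Lemma remainder_tame S T A B C D : remainder_state S T A B C D ->
  tame (lead_coef T) /\ eventually_ivt T.
Proof.
case=> _ TE T0 TS SP TQ _ sC sD _ _ tD _ nd.
have P0 := dividend_neq0; set j := (size T).-1.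
have gT : (0 < size T)%N by rewrite size_poly_gt0.
have jP : (j < (size P).-1)%N by rewrite /j; lia.
have jQ : (j <= (size Q).-1)%N by rewrite /j; lia.
have ndPQ : nondegenerate P Q j by apply: nd => //; apply: nondegenerate_last.
have det0 := det_subres_neq0 (ltnW jP) jQ P0 Q0 ndPQ.
have c0P : (0 < ((size Q).-1 - j) + ((size P).-1 - j))%N by lia.
pose c0 := Ordinal c0P.
have sC' : (size C <= (size Q).-1 - j)%N by rewrite /j; lia.
have sD' : (size D <= (size P).-1 - j)%N by rewrite /j; lia.
have sT : (size (C * P + D * Q)%R <= j.+1)%N by rewrite -TE /j; lia.
have [E1 E2] := subres_cramer (c0 := c0) (ltnW jP) jQ P0 Q0 erefl sC' sD' sT.
have kM : ((size D).-1 < (size P).-1 - j)%N by lia.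
have {}E2 := E2 _ kM.
rewrite -TE -!lead_coefE in E1 E2.
have tdet : tame (\det (subres_mx P Q j)).
  by apply: (tame_low ivt) => //; apply: size_det_subres.
have tT : tame (lead_coef T).
  (* By [E2] this product is [lead_coef T] times a minor of low degree, so [lead_coef T] is an exact
     quotient of tame polynomials. *)
  have t2 : tame (\det (subres_mx P Q j) * lead_coef D) by apply: tameM.
  rewrite E2 in t2; apply: tame_div t2 _; apply: (tame_low ivt).
    apply/eqP => a0; have := mulf_neq0 det0 tD.1.
    by rewrite E2 a0 mulr0 eqxx.
  have [sa|->] := size_adj_subres dP dQ P0 Q0 jP jQ (rshift _ (Ordinal kM)) (erefl (nat_of_ord c0)).
    by rewrite (leq_trans _ sa) // leq_addr.
  by rewrite size_poly0.
split=> //; apply: (eventually_ivt_prop tdet tT E1).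
apply: (eventually_ivt_low ivt) => x; exact: size_comb_adj.
Qed.

(** Horizontal slices inherit the degree bound from [P], so the hypothesis concerns vertical edges
    only. *)
Lemma size_edges_ivt (S : {poly {poly R}}) x0 x1 y0 y1 :
  (d <= d ^ 2)%N -> (size S <= size P)%N ->
  (forall x, ivt_on y0 y1 (specX S x)) -> edges_ivt x0 x1 y0 y1 S.
Proof.
move=> dd sS iS; have sY y : (size (specY S y) <= (d ^ 2).+1)%N.
  rewrite (leq_trans (size_poly _ _)) // (leq_trans sS) //.
  by rewrite (leq_trans (total_bound_size dP)).
by split=> //; apply: (IVT_ivt_on ivt).
Qed.

(** Induction on the size of [T]: swapping and one remainder step give [edge_sum T S = - edge_sum S
    T = edge_sum U T]; at [U = 0], [T] divides [c *: S] and the sum vanishes. *)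
Lemma remainder_edge_sum S T A B C D : (d <= d ^ 2)%N ->
  remainder_state S T A B C D -> exists z : seq R, forall x0 x1 y0 y1,
    x0 < x1 -> y0 < y1 -> avoids z y0 y1 ->
    (forall x y, x0 <= x <= x1 -> y0 <= y <= y1 ->
       ~ (S.[x, y] = 0 /\ T.[x, y] = 0)) ->
    edge_sum T S x0 x1 y0 y1 = 0.
Proof.
move=> dd; move: {2}(size T) (erefl (size T)) => n.
elim/ltn_ind: n S T A B C D => n IH S T A B C D Tn st.
have [tlT iT] := remainder_tame st.
have [zi Hi] := iT; have [lT0 [zl Hl]] := tlT.
case: (st) => SE TE T0 TS SP TQ sA sC sD sBD tS tD [zs Hs] nd.
have [e [K [U [E sU sK lK]]]] := signed_pseudo_division T0 (ltnW TS).
move: E lK; set c := _ ^+ (2 * e); move=> E lK.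
have c0 : c != 0 by rewrite expf_neq0.
have gT : (0 < size T)%N by rewrite size_poly_gt0.
have K0 : K != 0 by rewrite -size_poly_gt0 sK.
have tc : tame c by apply: tameX.
(* An exact quotient by [lK]; it is a factor of the leading coefficient of the next cofactor
   [K * D - c *: B]. *)
have tK : tame (lead_coef K).
  by apply: (@tame_div _ _ (lead_coef T)) => //; rewrite lK; apply: tameM.
have swap z x0 x1 y0 y1 : x0 < x1 -> y0 < y1 -> avoids (zl ++ (zi ++ zs) ++ z) y0 y1 ->
    (forall x y, x0 <= x <= x1 -> y0 <= y <= y1 ->
       ~ (S.[x, y] = 0 /\ T.[x, y] = 0)) ->
    edge_sum T S x0 x1 y0 y1 = - edge_sum S T x0 x1 y0 y1 /\
    (forall y, y0 <= y <= y1 -> 0 < c.[y]).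
  move=> hx hy /avoids_cat[zly /avoids_cat[/avoids_cat[ziy zsy] _]] nz; split.
    apply: edge_sum_swap => //; apply: size_edges_ivt => //.
    - by move=> x; apply: Hs.
    - by rewrite ltnW // (leq_trans TS).
    - by move=> x; apply: Hi.
  move=> y yin; have := avoids_nonzero Hl hy zly yin.
  by rewrite /c horner_exp => ly; rewrite exprn_even_gt0 ?ly ?orbT // oddM.
have [U0|U0] := eqVneq U 0.
  exists (zl ++ (zi ++ zs) ++ [::]) => x0 x1 y0 y1 hx hy zy nz.
  have [-> cpos] := swap [::] x0 x1 y0 y1 hx hy zy nz.
  rewrite (@edge_sum_dvd _ _ _ _ _ hx hy c K) ?oppr0 // => [y /cpos/gt_eqF->//|].
  by rewrite mul_polyC E U0 subr0.
have UE : U = (K * C - c *: A) * P + (K * D - c *: B) * Q.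
  have -> : U = K * T - c *: S by rewrite E; ring.
  by rewrite {1}TE {1}SE -!mul_polyC; ring.
have D0 : D != 0 by rewrite -size_poly_gt0; size_lia.
have sKD : size (K * D) = (size K + size D).-1 by rewrite size_mul.
have gD : (0 < size D)%N by rewrite size_poly_gt0.
(* [K] has positive degree because [size T < size S], so [K * D] keeps its leading term. *)
have ltB : (size (- (c *: B))%R < size (K * D)%R)%N.
  by rewrite size_polyN size_scale // sKD; size_lia.
have st' : remainder_state T U C D (K * C - c *: A) (K * D - c *: B).
  split=> //.
  - size_lia.
  - size_lia.
  - size_lia.
  - rewrite (leq_trans (size_polyD _ _)) // geq_max size_polyN size_scale // sA andbT.
    have [->|C0] := eqVneq C 0; first by rewrite mulr0 size_poly0.
    by rewrite size_mul //; move: C0; rewrite -size_poly_gt0; size_lia.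
  - by rewrite size_polyDl // sKD; size_lia.
  - by rewrite size_polyDl // sKD; size_lia.
  - by rewrite lead_coefDl // lead_coefM; apply: tameM.
  - move=> j jU H; apply: nd; first by size_lia.
    exact: (nondegenerate_step c0 U0 E).
have [z Hz] := IH (size U) ltac:(size_lia) T U _ _ _ _ erefl st'.
exists (zl ++ (zi ++ zs) ++ z) => x0 x1 y0 y1 hx hy zy nz.
have [-> cpos] := swap z x0 x1 y0 y1 hx hy zy nz.
rewrite -(@edge_sum_rem _ _ _ _ _ hx hy c K S U) //; last by rewrite mul_polyC.
apply: Hz => //; first by move: zy => /avoids_cat[_ /avoids_cat[]].
move=> x y xin yin [Txy Uxy]; apply: (nz x y xin yin); split=> //.
have := congr1 (fun p : {poly {poly R}} => p.[x, y]) E.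
rewrite hornerZ hornerD hornerN hornerM hornerM hornerD hornerN hornerM Txy Uxy.
rewrite mulr0 subr0 => /eqP; rewrite mulf_eq0 (gt_eqF (cpos y yin)) /=.
by move/eqP.
Qed.

Lemma pair_edge_sum : (d <= d ^ 2)%N -> exists z : seq R, forall x0 x1 y0 y1,
    x0 < x1 -> y0 < y1 -> avoids z y0 y1 ->
    (forall x y, x0 <= x <= x1 -> y0 <= y <= y1 ->
       ~ (P.[x, y] = 0 /\ Q.[x, y] = 0)) ->
    edge_sum Q P x0 x1 y0 y1 = 0.
Proof.
move=> dd; have P0 := dividend_neq0.
apply: (@remainder_edge_sum P Q 1 0 0 1) => //; split=> //.
- by rewrite mul1r mul0r addr0.
- by rewrite mul1r mul0r add0r.
- by rewrite size_poly1 subSnn.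
- by rewrite size_poly0.
- by rewrite size_poly1.
- by rewrite size_poly0.
- apply: (tame_low ivt); first by rewrite lead_coef_eq0.
  have := @dP (size P).-1; rewrite -lead_coefE /wdeg lead_coef_eq0 => /(_ P0) H.
  rewrite (leq_trans (leqSpred _)) // ltnS (leq_trans _ dd) //.
  by rewrite (leq_trans _ H) // leq_addr.
- by rewrite lead_coef1; apply: tame1.
- apply: (eventually_ivt_low ivt) => x.
  by rewrite (leq_trans (total_bound_specX x dP)).
Qed.

End RemainderSequence.

(** * Gluing generic and thin strips *)

Section Assembly.
Variables (R : realFieldType) (d : nat) (ivt : IVT R (d ^ 2)).
Hypothesis dd : (d <= d ^ 2)%N.
Variables (P Q : {poly {poly R}}).
Hypotheses (dP : total_bound d P) (dQ : total_bound d Q).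

Lemma total_bound_low (S : {poly {poly R}}) : total_bound d S -> low_degree (d ^ 2) S.
Proof.
by move=> dS t; split; rewrite (leq_trans _ (_ : d.+1 <= _)%N) //;
  [apply: total_bound_specX | apply: total_bound_specY].
Qed.

(** [z] cuts [[y0, y1]] into strips with exceptional heights at most at their ends. The two thin end
    strips are handled by [edge_sum_thin], and the middle one avoids [z]. *)
Lemma edge_sum_coprime x0 x1 y0 y1 : Q != 0 -> (size Q < size P)%N ->
  x0 < x1 -> y0 < y1 ->
  (forall x y, x0 <= x <= x1 -> y0 <= y <= y1 ->
     ~ (P.[x, y] = 0 /\ Q.[x, y] = 0)) ->
  edge_sum Q P x0 x1 y0 y1 = 0.
Proof.
move=> Q0 sQP hx hy nz.
have [z Hz] := pair_edge_sum ivt dP dQ Q0 sQP dd.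
have lP := total_bound_low dP; have lQ := total_bound_low dQ.
apply: (@interval_split_ind _ z y0 y1 (fun a b => edge_sum Q P x0 x1 a b = 0)) => //.
  by move=> a b c _ _ ab bc _ E1 E2; rewrite (edge_sum_splitY _ _ _ _ ab bc) E1 E2 addr0.
move=> a b ya ab by1 free.
have thin ys : y0 <= ys <= y1 -> exists2 e : R, 0 < e & forall u v, u < v ->
    `|u - ys| <= e -> `|v - ys| <= e -> edge_sum Q P x0 x1 u v = 0.
  by move=> yin; apply: (edge_sum_thin ivt) => // x xin; apply: nz.
have [|e e0 He] := thin a; first by lra.
have [|e' e'0 He'] := thin b; first by lra.
(* End strips of at most a third of the height leave [u < v]. *)
pose m := (b - a) / 3.
pose u := a + Num.min e m; pose v := b - Num.min e' m.
have [au ue um] : [/\ a < u, u - a <= e & u <= a + m].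
  rewrite /u; have := ge_min e e m; have := ge_min m e m; rewrite !lexx orbT => h1 h2.
  have : 0 < Num.min e m by rewrite lt_min e0 /m; lra.
  by split; lra.
have [vb ve vm] : [/\ v < b, b - v <= e' & b - m <= v].
  rewrite /v; have := ge_min e' e' m; have := ge_min m e' m; rewrite !lexx orbT => h1 h2.
  have : 0 < Num.min e' m by rewrite lt_min e'0 /m; lra.
  by split; lra.
have uv : u < v by rewrite /m in um vm; lra.
rewrite (edge_sum_splitY _ _ _ _ au (lt_trans uv vb)) (edge_sum_splitY _ _ _ _ uv vb).
have -> : edge_sum Q P x0 x1 a u = 0 by apply: He => //; rewrite ler_norml; lra.
have -> : edge_sum Q P x0 x1 v b = 0 by apply: He' => //; rewrite ler_norml; lra.
rewrite add0r addr0; apply: Hz => // [y yz uy yv|x y xin yin].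
  by apply: (free y) => //; lra.
by apply: nz => //; lra.
Qed.

End Assembly.

(** * Passage from [F] to its real and imaginary parts *)

Lemma total_bound_map (R : realFieldType) (d : nat) (f : R[i] -> R)
    (F : {poly {poly R[i]}}) : f 0 = 0 -> (total_degree F <= d)%N ->
  total_bound d (map_poly (map_poly f) F).
Proof.
move=> f0 dF k; have mf0 : map_poly f 0 = 0.
  by apply/polyP => j; rewrite coef_map_id0 // !coef0.
rewrite coef_map_id0 // => nz; have Fk : F`_k != 0.
  by apply: contraNneq nz => ->; rewrite mf0.
have kF : (k < size F)%N.
  by rewrite ltnNge; apply: contra Fk => /leq_sizeP/(_ k (leqnn k))/eqP.
have sk : (size (map_poly f F`_k) <= size (F`_k)%R)%N by apply: size_poly.
have H : (k + (size (F`_k)%R).-1 <= total_degree F)%N.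
  exact: (@leq_bigmax_cond _ _ (fun i : 'I_(size F) => i + (size (F`_i)%R).-1)%N (Ordinal kF)).
rewrite (leq_trans _ dF) // (leq_trans _ H) // addnC leq_add2l.
by rewrite -!subn1 leq_sub2r.
Qed.

Lemma horner_re_im (R : realFieldType) (F : {poly {poly R[i]}}) (x y : R) :
  F.[x%:C%C, y%:C%C] =
  ((re_part F).[x, y])%:C%C + Complex 0 1 * ((im_part F).[x, y])%:C%C.
Proof.
have [_ /(_ (conj erefl erefl)) FE] := re_im_partP F (re_part F) (im_part F).
rewrite [in LHS]FE.
have mapE (G : {poly {poly R}}) :
    (map_poly (map_poly (real_complex R)) G).[x%:C%C, y%:C%C] = (G.[x, y])%:C%C.
  have -> : (x%:C%C)%:P = map_poly (real_complex R) x%:P by rewrite map_polyC.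
  by rewrite !horner_map.
by rewrite !hornerE !mapE.
Qed.

Theorem lemma38 (R : realFieldType) (d : nat) (hd : (2 <= d)%N)
    (hIVT : IVT R (d ^ 2)%N)
    (x0 x1 y0 y1 : R) (hx : x0 < x1) (hy : y0 < y1)
    (F : {poly {poly R[i]}}) (hdeg : (total_degree F <= d)%N)
    (hF : forall x y : R, x0 <= x <= x1 -> y0 <= y <= y1 ->
            F.[x%:C%C, y%:C%C] != 0)
    (hwc : well_controlled F) :
  winding F x0 x1 y0 y1 = 0.
Proof.
have dd : (d <= d ^ 2)%N by rewrite expnS expn1 leq_pmull // ltnW.
case: hwc => U0 V0 sVU _.
have dU : total_bound d (re_part F) by apply: total_bound_map.
have dV : total_bound d (im_part F) by apply: total_bound_map.
have nz x y : x0 <= x <= x1 -> y0 <= y <= y1 ->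
    ~ ((re_part F).[x, y] = 0 /\ (im_part F).[x, y] = 0).
  move=> xin yin [Uxy Vxy]; have := hF x y xin yin.
  by rewrite horner_re_im Uxy Vxy mulr0 addr0 eqxx.
rewrite -[winding _ _ _ _ _]/(2^-1 * edge_sum (re_part F) (im_part F) x0 x1 y0 y1).
(* The remainder sequence starts with the part of larger [X]-degree; if this is the real part, the
   two are swapped first. *)
move: sVU; rewrite neq_ltn => /orP[sVU|sUV].
  have e G : total_bound d G -> edges_ivt x0 x1 y0 y1 G.
    by move=> dG; apply: (low_degree_edges hIVT); apply: total_bound_low.
  rewrite edge_sum_swap //; [|exact: e|exact: e|by move=> x y xin yin [? ?]; apply: (nz x y)].
  by rewrite (edge_sum_coprime hIVT dd dU dV) // oppr0 mulr0.
rewrite (edge_sum_coprime hIVT dd dV dU) ?mulr0 // => x y xin yin [? ?].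
exact: (nz x y).
Qed.
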